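(* Let $\beta\in[\mathbb{T}^2,\mathbb{K}^2]$ be a homotopy class of maps from the torus to the Klein bottle, and let $\beta_\#\in\mathrm{Hom}(\mathbb{Z}\oplus\mathbb{Z},\mathbb{Z}\rtimes\mathbb{Z})$ be the associated homomorphism of Type 1, 2, 3 or 4. For a non-zero integer $t$, let $e(t)$ denote its $2$-adic valuation. Then $\beta$ has the Borsuk-Ulam property with respect to $\tau_1$ if and only if one of the following conditions is satisfied: (a) $\beta_\#$ is a homomorphism of Type 3. (b) $\beta_\#$ is a homomorphism of Type 4, where $s_1$ is odd and $r_2\neq 0$, and additionally $e(r_1)>e(r_2)$ if $r_1\neq 0$.
   Context: $\mathbb{T}^2=\mathbb{R}^2/\mathbb{Z}^2$ is the torus and $\mathbb{K}^2$ is the Klein bottle; $[M,N]$ is the set of (free) homotopy classes of continuous maps $M\to N$. $\pi_1(\mathbb{T}^2,* )$ is identified with $\mathbb{Z}\oplus\mathbb{Z}$ in the standard way, and $\pi_1(\mathbb{K}^2,* )$ is identified with the non-trivial semi-direct product $\mathbb{Z}\rtimes\mathbb{Z}$, whose multiplication is $(m,n)(m',n')=(m+(-1)^n m',\,n+n')$. The free involution $\tau_1:\mathbb{T}^2\to\mathbb{T}^2$ is the one that lifts to $\widehat\tau_1:\mathbb{R}^2\to\mathbb{R}^2$, $\widehat\tau_1(x,y)=(x+\tfrac12,y)$. It is the non-trivial deck transformation of a double covering $c_1:\mathbb{T}^2\to\mathbb{T}^2$ which induces $(1,0)\mapsto(2,0)$, $(0,1)\mapsto(0,1)$ on $\pi_1$.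 Given a topological space $M$ with a free involution $\tau$ and a topological space $N$, a class $\beta\in[M,N]$ has the Borsuk-Ulam property with respect to $\tau$ if for every representative map $f:M\to N$ of $\beta$ there exists $x\in M$ such that $f(\tau(x))=f(x)$. Types of homomorphisms $\mathbb{Z}\oplus\mathbb{Z}\to\mathbb{Z}\rtimes\mathbb{Z}$: Type 1: $(1,0)\mapsto(i,2s_1+1)$, $(0,1)\mapsto(0,2s_2)$; Type 2: $(1,0)\mapsto(i,2s_1+1)$, $(0,1)\mapsto(i,2s_2+1)$; Type 3: $(1,0)\mapsto(0,2s_1)$, $(0,1)\mapsto(i,2s_2+1)$; Type 4: $(1,0)\mapsto(r_1,2s_1)$, $(0,1)\mapsto(r_2,2s_2)$; where $i\in\{0,1\}$ and $s_1,s_2\in\mathbb{Z}$ for Types 1, 2 and 3, and $r_1,r_2,s_1,s_2\in\mathbb{Z}$ with $r_1\geq0$ for Type 4. Given $\beta\in[\mathbb{T}^2,\mathbb{K}^2]$, choose a pointed map $f:(\mathbb{T}^2,* )\to(\mathbb{K}^2,* )$ that represents $\beta$ when basepoints are forgotten. The induced homomorphism $f_\#:\pi_1(\mathbb{T}^2,* )\to\pi_1(\mathbb{K}^2,* )$ is conjugate (by an element of $\mathbb{Z}\rtimes\mathbb{Z}$) to one of the homomorphisms listed above, and this homomorphism is denoted by $\beta_\#$. *)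

(* Defs.v *)
From HB Require Import structures.
From mathcomp Require Import all_boot all_order all_algebra generic_quotient.
From mathcomp Require Import all_classical all_reals topology normedtype.
From mathcomp Require Import homotopy.

Set Implicit Arguments.
Unset Strict Implicit.
Unset Printing Implicit Defensive.

Import Order.TTheory GRing.Theory Num.Theory.
Import numFieldNormedType.Exports.

Local Open Scope classical_set_scope.
Local Open Scope ring_scope.
Local Open Scope quotient_scope.

Section UnitInterval.
Context (R : realType).

Let I01 : set R := `[0, 1]%classic.

Let in_I01 (r : R) : (r \in I01) = (0 <= r <= 1).
Proof. by rewrite mem_setE in_itv. Qed.

Definition unit_interval : Type := set_type I01.

HB.instance Definition _ :=
  Topological.copy unit_interval (set_type I01).

Definition ui_val (s : unit_interval) : R := set_val s.

Let mk (r : R) (h : 0 <= r <= 1) : unit_interval :=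
  @exist R (fun x => x \in I01) r (etrans (in_I01 r) h).

Lemma ui_val_continuous : continuous ui_val.
Proof. exact: initial_continuous. Qed.

Lemma ui_val_inj : injective ui_val.
Proof. exact: val_inj. Qed.

Lemma ui_val_itv s : 0 <= ui_val s <= 1.
Proof. by rewrite -in_I01; exact: (valP s). Qed.

Let clamp_in (r : R) : 0 <= Num.max 0 (Num.min r 1) <= 1.
Proof. by rewrite le_max lexx /= ge_max ler01 ge_min lexx orbT. Qed.

Definition clamp (r : R) : unit_interval := mk (clamp_in r).

Lemma clampE r : 0 <= r <= 1 -> ui_val (clamp r) = r.
Proof.
by case/andP=> r0 r1; rewrite /ui_val /clamp set_valE /= min_l // max_r.
Qed.

Lemma clampK s : clamp (ui_val s) = s.
Proof. by apply: ui_val_inj; rewrite clampE // ui_val_itv. Qed.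

Lemma clamp_continuous : continuous clamp.
Proof.
apply: (@continuous_comp_initial _ _ _ (@set_val R I01)) => r.
apply: (@continuous_max _ _ (cst 0) (fun r : R => Num.min r 1)).
  exact: cst_continuous.
by apply: (@continuous_min _ _ id (cst 1)) => //; exact: cst_continuous.
Qed.

Let clamp0_neq1 : clamp 0 != clamp 1.
Proof.
apply/eqP => /(congr1 ui_val); rewrite !clampE ?lexx ?ler01 //.
by move/esym/eqP; rewrite oner_eq0.
Qed.

HB.instance Definition _ :=
  @isBiPointed.Build unit_interval (clamp 0) (clamp 1) clamp0_neq1.

Lemma ui_val0 : ui_val zero = 0.
Proof. by rewrite clampE ?lexx ?ler01. Qed.

Lemma ui_val1 : ui_val one = 1.
Proof. by rewrite clampE ?lexx ?ler01. Qed.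

End UnitInterval.

Lemma pair_continuous (X Y Z : topologicalType) (f : X -> Y) (g : X -> Z) :
  continuous f -> continuous g -> continuous (fun x => (f x, g x)).
Proof. by move=> cf cg x; apply: cvg_pair; [exact: cf | exact: cg]. Qed.

Section Homotopy.
Context (R : realType) (M N : topologicalType).
Local Notation I := (unit_interval R).
Implicit Types (A : set M) (f g h : continuousType M N).

Definition homotopic_rel A f g : Prop :=
  exists H : continuousType (I * M)%type N,
    [/\ forall x, H (zero, x) = f x,
        forall x, H (one, x) = g x &
        forall s x, A x -> H (s, x) = f x].

Lemma homotopic_rel_refl A f : homotopic_rel A f f.
Proof.
have c : continuous (f \o snd : (I * M)%type -> N).
  by move=> z; apply: continuous_comp; [exact: cvg_snd | exact: cts_fun].
by exists (mkcts c).
Qed.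

Lemma homotopic_rel_sym A f g : homotopic_rel A f g -> homotopic_rel A g f.
Proof.
case=> H [H0 H1 HA].
pose k (z : (I * M)%type) : (I * M)%type := (clamp (1 - ui_val z.1), z.2).
have ck : continuous k.
  apply: pair_continuous => z; last exact: cvg_snd.
  apply: (@continuous_comp _ _ _ (fun z : I * M => 1 - ui_val z.1) (@clamp R)).
    apply: cvgB; first exact: cvg_cst.
    by apply: continuous_comp; [exact: cvg_fst | exact: ui_val_continuous].
  exact: clamp_continuous.
have c : continuous (H \o k).
  by move=> z; apply: continuous_comp; [exact: ck | exact: cts_fun].
exists (mkcts c); split=> [x|x|s x Ax] /=; rewrite /mkcts /= /k /=.
- by rewrite ui_val0 subr0; exact: H1.
- by rewrite ui_val1 subrr; exact: H0.
- by rewrite HA // -(H1 x) HA.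
Qed.

Lemma homotopic_rel_trans A f g h :
  homotopic_rel A f g -> homotopic_rel A g h -> homotopic_rel A f h.
Proof.
case=> H [H0 H1 HA] [K [K0 K1 KA]].
pose u (z : (I * M)%type) : R := ui_val z.1.
have cu : continuous u.
  move=> z; apply: (@continuous_comp _ _ _ fst (@ui_val R)).
    exact: cvg_fst.
  exact: ui_val_continuous.
pose k1 (z : (I * M)%type) : (I * M)%type := (clamp (u z + u z), z.2).
pose k2 (z : (I * M)%type) : (I * M)%type := (clamp (u z + u z - 1), z.2).
have ck1 : continuous k1.
  apply: pair_continuous => z; last exact: cvg_snd.
  apply: (@continuous_comp _ _ _ (fun z : I * M => u z + u z) (@clamp R)).
    by apply: cvgD; exact: cu.
  exact: clamp_continuous.
have ck2 : continuous k2.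
  apply: pair_continuous => z; last exact: cvg_snd.
  apply: (@continuous_comp _ _ _ (fun z : I * M => u z + u z - 1) (@clamp R)).
    by apply: cvgB; [apply: cvgD; exact: cu | exact: cvg_cst].
  exact: clamp_continuous.
have cH : continuous (H \o k1).
  by move=> z; apply: continuous_comp; [exact: ck1 | exact: cts_fun].
have cK : continuous (K \o k2).
  by move=> z; apply: continuous_comp; [exact: ck2 | exact: cts_fun].
pose L (z : (I * M)%type) : N :=
  if u z <= 2^-1 then (H \o k1) z else (K \o k2) z.
have half2 : 2^-1 + 2^-1 = 1 :> R by rewrite [RHS]splitr div1r.
have cL : continuous L.
  apply/continuous_subspace_setT.
  have -> : [set: (I * M)%type] =
      (u @^-1` [set r | r <= 2^-1]) `|` (u @^-1` [set r | 2^-1 <= r]).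
    apply/esym; rewrite -subTset => z _ /=.
    by case: (leP (u z) 2^-1) => [|/ltW]; [left|right].
  apply: withinU_continuous.
  - by apply: preimage_closed => //; exact: closed_le.
  - by apply: preimage_closed => //; exact: closed_ge.
  - apply: (@subspace_eq_continuous _ _ _ (H \o k1)).
      move=> z /set_mem uz; rewrite /from_subspace /L.
      by have -> : (u z <= 2^-1) = true by exact: uz.
    exact: continuous_subspaceT.
  - apply: (@subspace_eq_continuous _ _ _ (K \o k2)).
      move=> z /set_mem uz; rewrite /from_subspace /L; case: ifP => // uz'.
      have {uz uz'} e : u z = 2^-1 by apply/eqP; rewrite eq_le uz uz'.
      rewrite /= /k1 /k2 e half2 subrr.
      by rewrite K0 (H1 z.2).
    exact: continuous_subspaceT.
exists (mkcts cL); split=> [x|x|s x Ax] /=; rewrite /mkcts /L /u /k1 /k2 /=.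
- by rewrite ui_val0 invr_ge0 ler0n /= /u /= ui_val0 addr0 H0.
- by rewrite ui_val1 invf_ge1 ?ltr0n // lern1 /= /u /= ui_val1 addrK K1.
- by case: ifP => _; rewrite ?HA ?KA // -(H1 x) HA.
Qed.

Definition homotopicb A f g : bool := `[< homotopic_rel A f g >].

Lemma homotopicb_equiv A : equiv_class_of (homotopicb A).
Proof.
split.
- by move=> f; apply/asboolP; exact: homotopic_rel_refl.
- move=> f g; apply/idP/idP => /asboolP h; apply/asboolP;
  exact: homotopic_rel_sym.
- move=> g f h /asboolP fg /asboolP gh; apply/asboolP.
  exact: homotopic_rel_trans gh.
Qed.


Canonical homotopy_equiv := EquivRelPack (homotopicb_equiv set0).

(* Homotopies are free here: they are relative to the empty set. *)
Definition homotopy_class : Type := {eq_quot homotopy_equiv}.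

HB.instance Definition _ := Choice.on homotopy_class.
HB.instance Definition _ := EqQuotient.on homotopy_class.

Definition represents (f : continuousType M N) (beta : homotopy_class) : Prop :=
  \pi_homotopy_class f = beta.

End Homotopy.

Section FundamentalGroup.
Context (R : realType) (X : topologicalType) (x0 : X).
Local Notation I := (unit_interval R).

Definition loop : Type := {path I from x0 to x0 in X}.

HB.instance Definition _ := Choice.on loop.

Definition path_homotopicb (p q : loop) : bool :=
  homotopicb R [set zero; one] p q.

Lemma path_homotopicb_equiv : equiv_class_of path_homotopicb.
Proof.
have [r s t] := @homotopicb_equiv R _ X [set (zero : I); one].
by split=> [p|p q|p q p']; [exact: r | exact: s | exact: t].
Qed.

Canonical path_homotopy_equiv := EquivRelPack path_homotopicb_equiv.

(* Underlying set of the fundamental group of (X, x0). The group law is not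
   needed: homomorphisms are compared after the explicit identifications
   [torus_pi1] and [klein_pi1] below. *)
Definition pi1 : Type := {eq_quot path_homotopy_equiv}.

HB.instance Definition _ := Choice.on pi1.
HB.instance Definition _ := EqQuotient.on pi1.

End FundamentalGroup.

Section InducedMap.
Context (R : realType) (X Y : topologicalType) (x0 : X) (y0 : Y).
Local Notation I := (unit_interval R).
Context (f : continuousType X Y) (fx0 : f x0 = y0).

Let comp_cts (p : loop R x0) : continuous (f \o p).
Proof. by move=> s; apply: continuous_comp; exact: cts_fun. Qed.

Let comp0 (p : loop R x0) : (f \o p) zero = y0.
Proof. by rewrite /= path_zero. Qed.

Let comp1 (p : loop R x0) : (f \o p) one = y0.
Proof. by rewrite /= path_one. Qed.

Definition loop_map (p : loop R x0) : loop R y0 :=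
  mk_path (comp_cts (p := p)) (comp0 p) (comp1 p).

Definition pi1_map (c : pi1 R x0) : pi1 R y0 :=
  \pi_(pi1 R y0) (loop_map (repr c)).

Lemma pi1_mapE (p : loop R x0) :
  pi1_map (\pi_(pi1 R x0) p) = \pi_(pi1 R y0) (loop_map p).
Proof.
rewrite /pi1_map; case: piP => q /eqmodP /asboolP [H [H0 H1 HA]].
apply/esym/eqmodP/asboolP.
have c : continuous (f \o H).
  by move=> z; apply: continuous_comp; exact: cts_fun.
exists (mkcts c); split=> [s|s|s t st] /=; rewrite /mkcts /=.
- by rewrite H0.
- by rewrite H1.
- by rewrite HA.
Qed.

End InducedMap.

(* The non-trivial semi-direct product of Z by Z, as an alias of Z x Z that
   carries the twisted law below. *)
Definition ZsZ : Type := (int * int)%type.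

HB.instance Definition _ := Choice.on ZsZ.

Section SemidirectProduct.
Implicit Types g h k : ZsZ.

Definition zsz_one : ZsZ := (0, 0).
Definition zsz_mul g h : ZsZ := (g.1 + (-1) ^ g.2 * h.1, g.2 + h.2).
Definition zsz_inv g : ZsZ := (- ((-1) ^ (- g.2) * g.1), - g.2).

Let signD (m n : int) : (-1 : int) ^ (m + n) = (-1) ^ m * (-1) ^ n.
Proof. by rewrite exprzDr // unitrN1. Qed.

Lemma zsz_mulA : associative zsz_mul.
Proof.
by move=> [a b] [c d] [e f]; rewrite /zsz_mul /= signD mulrDr !addrA mulrA.
Qed.

Lemma zsz_mul1 : left_id zsz_one zsz_mul.
Proof. by move=> [a b]; rewrite /zsz_mul /= expr0z mul1r !add0r. Qed.

Lemma zsz_mulr1 : right_id zsz_one zsz_mul.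
Proof. by move=> [a b]; rewrite /zsz_mul /= mulr0 !addr0. Qed.

Lemma zsz_mulV : left_inverse zsz_one zsz_inv zsz_mul.
Proof. by move=> [a b]; rewrite /zsz_mul /zsz_inv /= !addNr. Qed.

Lemma zsz_mulrV : right_inverse zsz_one zsz_inv zsz_mul.
Proof.
move=> [a b]; rewrite /zsz_mul /zsz_inv /= mulrN mulrA -signD.
by rewrite subrr expr0z mul1r subrr.
Qed.

HB.instance Definition _ :=
  isGroup.Build ZsZ zsz_mulA zsz_mul1 zsz_mulr1 zsz_mulV zsz_mulrV.

End SemidirectProduct.

Section Torus.
Context (R : realType).
Local Notation R2 := (R * R)%type.

Definition torus_shift (v : int * int) (p : R2) : R2 :=
  (p.1 + v.1%:~R, p.2 + v.2%:~R).

Definition torus_rel (p q : R2) : bool := `[< exists v, q = torus_shift v p >].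

Lemma torus_rel_equiv : equiv_class_of torus_rel.
Proof.
have sy p q : torus_rel p q -> torus_rel q p.
  move=> /asboolP [v ->]; apply/asboolP; exists (- v.1, - v.2).
  by case: p => x y; rewrite /torus_shift /= !mulrNz !addrK.
split.
- case=> x y; apply/asboolP; exists (0, 0).
  by rewrite /torus_shift /= !addr0.
- by move=> p q; apply/idP/idP; exact: sy.
- move=> q p r /asboolP [v ->] /asboolP [w ->]; apply/asboolP.
  exists (v.1 + w.1, v.2 + w.2).
  by rewrite /torus_shift /= !intrD !addrA.
Qed.

Canonical torus_equiv := EquivRelPack torus_rel_equiv.

Definition torus : Type := {eq_quot torus_equiv}.

HB.instance Definition _ := Topological.copy torus (quotient_topology torus).
HB.instance Definition _ := Quotient.on torus.

Definition torus_pi (p : R2) : torus := \pi_torus p.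

Lemma torus_piP p q :
  torus_pi p = torus_pi q <-> exists v, q = torus_shift v p.
Proof. by split=> [/eqmodP /asboolP//|e]; apply/eqmodP/asboolP. Qed.

Lemma torus_pi_continuous : continuous torus_pi.
Proof. exact: pi_continuous. Qed.

Definition torus_base : torus := torus_pi (0, 0).

End Torus.

Section KleinBottle.
Context (R : realType).
Local Notation R2 := (R * R)%type.

(* Z x| Z acting on the plane by deck transformations; the orbit of the origin
   is the integer lattice, g sending (0, 0) to g itself. *)
Definition klein_act (g : ZsZ) (p : R2) : R2 :=
  (g.1%:~R + (-1) ^ g.2 * p.1, g.2%:~R + p.2).

Let signD (m n : int) : (-1 : R) ^ (m + n) = (-1) ^ m * (-1) ^ n.
Proof. by rewrite exprzDr // unitrN1. Qed.

Lemma klein_act1 p : klein_act 1%g p = p.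
Proof. by case: p => x y; rewrite /klein_act /= expr0z mul1r !add0r. Qed.

Lemma klein_actM g h p : klein_act (g * h)%g p = klein_act g (klein_act h p).
Proof.
case: g h p => [a b] [c d] [x y].
rewrite /klein_act /= !intrD intrM signD mulrDr !addrA mulrA.
by rewrite rmorphXz ?unitrN1 // rmorphN1.
Qed.

Definition klein_rel (p q : R2) : bool := `[< exists g, q = klein_act g p >].

Lemma klein_rel_equiv : equiv_class_of klein_rel.
Proof.
have sy p q : klein_rel p q -> klein_rel q p.
  move=> /asboolP [g ->]; apply/asboolP; exists (g^-1)%g.
  by rewrite -klein_actM mulVg klein_act1.
split.
- by move=> p; apply/asboolP; exists 1%g; rewrite klein_act1.
- by move=> p q; apply/idP/idP; exact: sy.
- move=> q p r /asboolP [g ->] /asboolP [h ->]; apply/asboolP.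
  by exists (h * g)%g; rewrite klein_actM.
Qed.

Canonical klein_equiv := EquivRelPack klein_rel_equiv.

Definition klein : Type := {eq_quot klein_equiv}.

HB.instance Definition _ := Topological.copy klein (quotient_topology klein).
HB.instance Definition _ := Quotient.on klein.

Definition klein_pi (p : R2) : klein := \pi_klein p.

Lemma klein_piP p q :
  klein_pi p = klein_pi q <-> exists g, q = klein_act g p.
Proof. by split=> [/eqmodP /asboolP//|e]; apply/eqmodP/asboolP. Qed.

Lemma klein_pi_continuous : continuous klein_pi.
Proof. exact: pi_continuous. Qed.

Definition klein_base : klein := klein_pi (0, 0).

End KleinBottle.

Section Identifications.
Context (R : realType).
Local Notation I := (unit_interval R).
Local Notation R2 := (R * R)%type.

Definition segment (v : int * int) (t : I) : R2 :=
  (ui_val t * v.1%:~R, ui_val t * v.2%:~R).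

Lemma segment_continuous v : continuous (segment v).
Proof.
have c (r : R) : continuous (fun t : I => ui_val t * r).
  move=> t; apply: (@continuousM _ _ (@ui_val R) (cst r)).
    exact: ui_val_continuous.
  exact: cst_continuous.
by apply: pair_continuous; exact: c.
Qed.

Lemma segment0 v : segment v zero = (0, 0).
Proof. by rewrite /segment ui_val0 !mul0r. Qed.

Lemma segment1 v : segment v one = (v.1%:~R, v.2%:~R).
Proof. by rewrite /segment ui_val1 !mul1r. Qed.

Section TorusLoop.
Context (v : int * int).

Let cts : continuous (@torus_pi R \o segment v).
Proof.
move=> t; apply: continuous_comp; first exact: segment_continuous.
exact: torus_pi_continuous.
Qed.

Let at0 : (@torus_pi R \o segment v) zero = torus_base R.
Proof. by rewrite /= segment0. Qed.

Let at1 : (@torus_pi R \o segment v) one = torus_base R.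
Proof.
rewrite /= segment1; apply/esym/torus_piP; exists v.
by rewrite /torus_shift /= !add0r.
Qed.

Definition torus_loop : loop R (torus_base R) := mk_path cts at0 at1.

End TorusLoop.

Section KleinLoop.
Context (g : ZsZ).

Let cts : continuous (@klein_pi R \o segment g).
Proof.
move=> t; apply: continuous_comp; first exact: segment_continuous.
exact: klein_pi_continuous.
Qed.

Let at0 : (@klein_pi R \o segment g) zero = klein_base R.
Proof. by rewrite /= segment0. Qed.

Let at1 : (@klein_pi R \o segment g) one = klein_base R.
Proof.
rewrite /= segment1; apply/esym/klein_piP; exists g.
by rewrite /klein_act /= mulr0 !addr0.
Qed.

Definition klein_loop : loop R (klein_base R) := mk_path cts at0 at1.

End KleinLoop.

(* The identifications of the fundamental groups with Z (+) Z and Z x| Z: an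
   element corresponds to the loops whose lift at the origin ends at the image
   of the origin under that deck transformation. *)
Definition torus_pi1 (v : int * int) : pi1 R (torus_base R) :=
  \pi_(pi1 R (torus_base R)) (torus_loop v).

Definition klein_pi1 (g : ZsZ) : pi1 R (klein_base R) :=
  \pi_(pi1 R (klein_base R)) (klein_loop g).

End Identifications.

Record free_involution (M : topologicalType) := FreeInvolution {
  fi_fun :> M -> M;
  fi_continuous : continuous fi_fun;
  fi_involutive : involutive fi_fun;
  fi_free : forall x, fi_fun x <> x
}.

Definition borsuk_ulam (R : realType) (M N : topologicalType)
    (tau : free_involution M) (beta : homotopy_class R M N) : Prop :=
  forall f : continuousType M N, represents f beta ->
    exists x : M, f (tau x) = f x.

Section Tau1.
Context (R : realType).
Local Notation R2 := (R * R)%type.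

Definition tau1_lift (p : R2) : R2 := (p.1 + 2^-1, p.2).

Definition tau1_fun (x : torus R) : torus R := torus_pi (tau1_lift (repr x)).

Lemma tau1_funE p : tau1_fun (torus_pi p) = torus_pi (tau1_lift p).
Proof.
rewrite /tau1_fun; have := reprK (torus_pi p).
move: (repr _) => q /torus_piP [v ->]; apply/torus_piP; exists v.
by rewrite /torus_shift /tau1_lift /= addrAC.
Qed.

Let torus_ind (P : torus R -> Prop) :
  (forall p, P (torus_pi p)) -> forall x, P x.
Proof. by move=> h x; rewrite -[x]reprK; exact: h. Qed.

Lemma tau1_fun_continuous : continuous tau1_fun.
Proof.
apply/quotient_continuous.
have -> : tau1_fun \o \pi_(torus R) = @torus_pi R \o tau1_lift.
  by apply/funext => p; exact: tau1_funE.
move=> p; apply: continuous_comp; last exact: torus_pi_continuous.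
apply: (pair_continuous (f := fun p : R2 => p.1 + 2^-1)) => q.
  by apply: cvgD; [exact: cvg_fst | exact: cvg_cst].
exact: cvg_snd.
Qed.

Lemma tau1_fun_involutive : involutive tau1_fun.
Proof.
elim/torus_ind => -[x y]; rewrite !tau1_funE.
apply/esym/torus_piP; exists (1, 0).
rewrite /torus_shift /tau1_lift /= addr0 -addrA; congr (_ + _, _).
by rewrite [RHS]splitr div1r.
Qed.

Lemma tau1_fun_free x : tau1_fun x <> x.
Proof.
elim/torus_ind: x => -[x y]; rewrite tau1_funE => /esym/torus_piP [[m n]].
move=> [/addrI e _]; have : (2 * m)%:~R = 1%:~R :> R.
  by rewrite intrM -e mulfV // pnatr_eq0.
move/intr_inj => {}e; by have : (2 %| 2 * m)%Z by [exact: dvdz_mulr]; rewrite e.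
Qed.

Definition tau1 : free_involution (torus R) :=
  FreeInvolution tau1_fun_continuous tau1_fun_involutive tau1_fun_free.

End Tau1.

Section HomTypes.
Implicit Types phi : int * int -> ZsZ.

Definition is_hom phi : Prop := {morph phi : u v / u + v >-> (u * v)%g}.

Definition type1 phi : Prop := exists i s1 s2 : int,
  [/\ i = 0 \/ i = 1, phi (1, 0) = (i, 2 * s1 + 1) & phi (0, 1) = (0, 2 * s2)].

Definition type2 phi : Prop := exists i s1 s2 : int,
  [/\ i = 0 \/ i = 1, phi (1, 0) = (i, 2 * s1 + 1)
    & phi (0, 1) = (i, 2 * s2 + 1)].

Definition type3 phi : Prop := exists i s1 s2 : int,
  [/\ i = 0 \/ i = 1, phi (1, 0) = (0, 2 * s1) & phi (0, 1) = (i, 2 * s2 + 1)].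

Definition type4_with phi (r1 r2 s1 s2 : int) : Prop :=
  [/\ 0 <= r1, phi (1, 0) = (r1, 2 * s1) & phi (0, 1) = (r2, 2 * s2)].

Definition type4 phi : Prop := exists r1 r2 s1 s2, type4_with phi r1 r2 s1 s2.

End HomTypes.

(* [phi] is a homomorphism of Type 1, 2, 3 or 4 conjugate to the homomorphism
   induced by some pointed representative of [beta]. *)
Definition beta_sharp (R : realType)
    (beta : homotopy_class R (torus R) (klein R)) (phi : int * int -> ZsZ) :
    Prop :=
  [/\ is_hom phi, type1 phi \/ type2 phi \/ type3 phi \/ type4 phi &
      exists (f : continuousType (torus R) (klein R))
             (fb : f (torus_base R) = klein_base R) (g : ZsZ),
        represents f beta /\
        forall v, pi1_map fb (torus_pi1 R v) = klein_pi1 R (phi v ^ g)%g].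

(* The 2-adic valuation, meaningful for t <> 0 only: val2 0 = 0. *)
Definition val2 (t : int) : nat := logn 2 `|t|%N.

(* Main.v *)
(** Both the plane over the torus and the plane over the Klein bottle carry
    deck transformations acting by affine isometries.  A map in the class [beta]
    lifts to a continuous [F : R^2 -> R^2] with [F (p + v) = phi v . F p], and,
    since the action is affine, segments between two such lifts stay
    [phi]-equivariant: the class [beta] is exactly the set of maps induced by
    [phi]-equivariant [F].  Hence [beta] has the Borsuk-Ulam property iff every
    equivariant [F] sends some [p] and [p + (1/2, 0)] to the same deck orbit.

    Write [F = (a, b)].  In the negative cases an explicit [F] (affine plus a
    small sine) has no such [p].  In the positive cases the condition on [p] is
    the common vanishing of two functions [D], [E], where [D] changes sign under
    [(1/2, 0)] and not under [(0, 1)], while [E] changes sign under [(0, 1)] and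
    is even or odd under [(1/2, 0)].  If [(D, E)] never vanished, its angle
    would lift to [theta] with [theta (p + (1, 0)) = pi - theta p + c] and
    [theta (p + (0, 1)) = c' - theta p] (period 1/2 rescaled to 1, [E] even) for
    some [c], [c'] in [2 pi Z]; computing [theta (p + (1, 1))] in two ways gives
    [pi = c' - c], which is absurd. *)
Require Import Defs.
From mathcomp Require Import all_boot all_order all_algebra generic_quotient.
From mathcomp Require Import all_classical all_reals topology normedtype.
From mathcomp Require Import homotopy realfun trigo.
From mathcomp Require Import zify lra ring.

Set Implicit Arguments.
Unset Strict Implicit.
Unset Printing Implicit Defensive.

Import Order.TTheory GRing.Theory Num.Theory.
Import numFieldNormedType.Exports.

Local Open Scope classical_set_scope.
Local Open Scope ring_scope.
Local Open Scope quotient_scope.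

(** * Lifting maps from a normed space through a map with separated fibres *)

Lemma near_dist_lt (R : realType) (V : normedModType R) (x : V) (e : R) :
  0 < e -> \forall y \near x, `|x - y| < e.
Proof. by move=> e0; apply: (@cvgr_dist_lt _ _ _ (nbhs x) _ id x). Qed.

Section Lifting.
Context (R : realType) (V E : normedModType R) (B : Type) (P : E -> B).

(** A uniform gap in the fibres stands in for evenly covered neighbourhoods. The radius [1] suits
    both coverings in use: a non-trivial deck transformation over the Klein bottle moves every point
    by at least [1], and two angles of one point of the circle differ by a multiple of [2 * pi]. *)
Definition evenly_separated : Prop :=
  forall q q' : E, P q = P q' -> `|q - q'| < 1 -> q = q'.

Definition locally_liftable (Phi : V -> B) : Prop :=
  forall p (e : R), 0 < e -> exists2 d : R, 0 < d &
    forall p1 p2, `|p - p1| < d -> `|p - p2| < d ->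
    forall q, P q = Phi p1 -> exists2 q', P q' = Phi p2 & `|q - q'| < e.

(** The bound [4^-1] is chosen because comparing two nearby lifts passes through four errors, whose
    sum has to stay below the gap [1]. *)
Definition uniformly_liftable (Phi : V -> B) : Prop :=
  exists2 d : R, 0 < d & forall p p', `|p - p'| < d ->
    forall q, P q = Phi p -> exists2 q', P q' = Phi p' & `|q - q'| < 4^-1.

(** Along the segment from [x0] to [x] the distance between the lifts starts at [0] and cannot take
    the value [2^-1], since separation would make it [0] there. So it stays below [1], and
    separation applies at [x]. *)
Lemma lift_unique (F F' : V -> E) (x0 : V) :
  evenly_separated -> continuous F -> continuous F' ->
  (forall x, P (F x) = P (F' x)) -> F x0 = F' x0 -> forall x, F x = F' x.
Proof.
move=> sep cF cF' PF e0 x.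
pose l (t : R) : V := x0 + t *: (x - x0).
have cl : continuous l.
  move=> t; apply: cvgD; first exact: cvg_cst.
  by apply: cvgZr_tmp; exact: cvg_id.
pose g t := `|F (l t) - F' (l t)|.
have cg : continuous g.
  move=> t; apply: (@cvg_norm _ _ _ _ _ (fun t => F (l t) - F' (l t))).
  by apply: cvgB; apply: continuous_comp;
     [exact: cl|exact: cF|exact: cl|exact: cF'].
have g0 : g 0 = 0 by rewrite /g /l scale0r addr0 e0 subrr normr0.
have l1 : l 1 = x by rewrite /l scale1r addrC subrK.
suff g1 : g 1 < 1 by have := sep _ _ (PF (l 1)) g1; rewrite l1.
rewrite ltNge; apply/negP => g1.
have [||c _ gc] := @IVT _ g 0 1 2^-1 ler01.
- exact: continuous_subspaceT cg.
- rewrite g0; apply/andP; split; first by rewrite ge_min; apply/orP; left; lra.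
  by rewrite le_max; apply/orP; right; lra.
have : F (l c) = F' (l c) by apply: sep => //; rewrite -/(g c) gc; lra.
by move/eqP; rewrite -subr_eq0 -normr_eq0 -/(g c) gc => /eqP; lra.
Qed.

(** Compactness gives a common radius over [W]. Each [p] is carried into [W] by a map that preserves
    [Phi] and does not increase distances, so the radius serves everywhere. *)
Lemma liftable_uniformly (Phi : V -> B) (W : set V) :
  locally_liftable Phi -> compact W ->
  (forall p, exists h : V -> V, [/\ W (h p),
     forall x, Phi (h x) = Phi x & forall x y, `|h x - h y| <= `|x - y|]) ->
  uniformly_liftable Phi.
Proof.
move=> ll /compact_near_coveringP cW hW.
pose Q (d : R) w := forall p', `|w - p'| < d ->
    forall q, P q = Phi w -> exists2 q', P q' = Phi p' & `|q - q'| < 4^-1.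
have : \forall d \near (0 : R), W `<=` Q d.
  apply: (cW R (nbhs (0 : R)) Q _ _).
  move=> x Wx; have [|d d0 Hd] := ll x 4^-1; first lra.
  have d20 : 0 < d / 2 by lra.
  near=> y e => p' /= ye q Pq.
  have xy : `|x - y| < d / 2 by near: y; exact: near_dist_lt.
  have ed : e < d / 2.
    by near: e; apply: (@cvgr_lt _ _ (nbhs (0 : R)) _ id 0).
  have := ler_distD y x p' => xp'.
  by apply: (Hd y p' _ _ q Pq); lra.
move=> /nbhs_ballP[d /= d0 Hd]; exists (d / 2); first lra.
move=> p p' pp' q Pq; have [h [Wh Ph hl]] := hW p.
rewrite -(Ph p'); apply: (Hd (d / 2)) Wh _ _ _ _.
- by rewrite /ball /= sub0r normrN gtr0_norm; lra.
- by apply: le_lt_trans pp'; exact: hl.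
- by rewrite Ph.
Unshelve. all: by end_near. Qed.

(** Local liftability offers a point over [Phi y] close to [H x]. Since [H] follows the continuous
    [G], this point is within [1] of [H y], hence equal to it. *)
Lemma near_lift_continuous (Phi : V -> B) (G H : V -> E) :
  evenly_separated -> locally_liftable Phi -> continuous G ->
  (forall x, P (H x) = Phi x) -> (forall x, `|G x - H x| < 4^-1) ->
  continuous H.
Proof.
move=> sep ll cG PH GH x; apply/cvgrPdist_lt => e e0.
have m0 : 0 < Num.min e 4^-1 by rewrite lt_min e0; lra.
have [d d0 Hd] := ll x _ m0.
near=> y.
have xx : `|x - x| < d by rewrite subrr normr0.
have xy : `|x - y| < d by near: y; exact: near_dist_lt.
have [q' Pq'] := Hd x y xx xy (H x) (PH x).
rewrite lt_min => /andP[q'e q'4].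
suff -> : H y = q' by [].
apply: sep; first by rewrite PH Pq'.
have Gxy : `|G x - G y| < 4^-1.
  by near: y; apply: cvgr_dist_lt; [exact: cG|lra].
have := GH x; have := GH y.
have := ler_distD (G y) (H y) q'; have := ler_distD (G x) (G y) q'.
have := ler_distD (H x) (G x) q'.
 rewrite (distrC (H y) (G y)) (distrC (G y) (G x)).
lra.
Unshelve. all: by end_near. Qed.

Lemma locally_liftable_comp (Phi : V -> B) (l : V -> V) :
  locally_liftable Phi -> continuous l -> locally_liftable (Phi \o l).
Proof.
move=> ll cl p e e0; have [d d0 Hd] := ll (l p) e e0.
have /cvgrPdist_lt/(_ d d0)/nbhs_ballP[d' /= d'0 Hd'] := cl p.
exists d' => // p1 p2 h1 h2 q Pq.
by apply: (Hd (l p1) (l p2)) => //; apply: Hd'; rewrite -ball_normE.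
Qed.

(* The radial maps [l k] push [V] out from [0] in steps shorter than [d], so a
   lift of [Phi \o l k] determines a nearby lift of [Phi \o l k.+1]; around
   each point the lifts are eventually constant in [k]. *)
Lemma lift_exists (Phi : V -> B) (q0 : E) :
  evenly_separated -> locally_liftable Phi -> uniformly_liftable Phi ->
  P q0 = Phi 0 ->
  exists F : V -> E, [/\ continuous F, forall x, P (F x) = Phi x & F 0 = q0].
Proof.
move=> sep ll [d d0 Hd] Pq0.
(* The denominator bounds each step by [d] times a ratio less than [1], uniformly in [x], while
   [l k x] still reaches [x] after finitely many steps. *)
pose c (k : nat) (x : V) : R := Num.min 1 (k%:R * d / (1 + `|x|)).
have x1 (x : V) : 0 < 1 + `|x| by have := normr_ge0 x; lra.
pose l k x := c k x *: x.
have cl k : continuous (l k).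
  move=> x; apply: cvgZ; last exact: cvg_id.
  apply: (@continuous_min _ _ (cst 1) (fun x => k%:R * d / (1 + `|x|))).
    exact: cvg_cst.
  apply: cvgM; first exact: cvg_cst.
  apply: cvgV; first by rewrite gt_eqF.
  by apply: cvgD; [exact: cvg_cst | exact: norm_continuous].
have l0 x : l 0%N x = 0.
  by rewrite /l /c !mul0r min_r ?ler01 // scale0r.
have lk0 k : l k 0 = 0 by rewrite /l scaler0.
have step k x : `|l k x - l k.+1 x| < d.
  rewrite /l -scalerBl normrZ.
  have c_le : `|c k x - c k.+1 x| <= d / (1 + `|x|).
    have -> : c k.+1 x = Num.min 1 (k%:R * d / (1 + `|x|) + d / (1 + `|x|)).
      by rewrite /c -natr1 mulrDl mul1r mulrDl.
    have : 0 <= d / (1 + `|x|) by apply: divr_ge0; apply: ltW.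
    rewrite /c; move: (k%:R * d / _) (d / _) => a b b0.
    by rewrite !minEle; case: ifP; case: ifP; rewrite ler_norml; lra.
  apply: (le_lt_trans (ler_wpM2r (normr_ge0 x) c_le)).
  rewrite mulrAC ltr_pdivrMr // ltr_pM2l //.
  by have := normr_ge0 x; lra.
have stab k x : (1 + `|x|) / d <= k%:R -> l k x = x.
  move=> h; rewrite /l /c min_l ?scale1r //.
  by rewrite ler_pdivlMr // mul1r -ler_pdivrMr.
(* The default [0] is never taken: by [step] and uniform liftability the set of candidates is
   inhabited. *)
pose G := fix G k : V -> E := if k is k'.+1 then fun x =>
  xget 0 [set q | P q = Phi (l k'.+1 x) /\ `|G k' x - q| < 4^-1]
  else cst q0.
have GP k : forall x, P (G k x) = Phi (l k x).
  elim: k => [x|k IH x] /=; first by rewrite l0.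
  have [q Pq hq] := Hd _ _ (step k x) _ (IH x).
  by case: xgetP => [y _ []//|/(_ q)]; case; split.
have Gn k x : `|G k x - G k.+1 x| < 4^-1.
  have [q Pq hq] := Hd _ _ (step k x) _ (GP k x).
  by rewrite /=; case: xgetP => [y _ []//|/(_ q)]; case; split.
have cG k : continuous (G k).
  elim: k => [|k IH]; first by move=> x; exact: cvg_cst.
  apply: (@near_lift_continuous (Phi \o l k.+1) (G k) (G k.+1)) => //.
      exact: locally_liftable_comp.
have Gstab k m x : (1 + `|x|) / d <= k%:R -> G (k + m)%N x = G k x.
  move=> h; elim: m => [|m IH]; first by rewrite addn0.
  rewrite addnS -IH; apply/esym/sep; last by apply: lt_trans (Gn _ _) _; lra.
  rewrite !GP !stab //; apply: le_trans h _; rewrite ler_nat ?leq_addr //.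
  by rewrite -addnS leq_addr.
pose N (x : V) : nat := (Num.truncn ((1 + `|x|) / d)).+1.
have NP x : (1 + `|x|) / d <= (N x)%:R.
  by apply: ltW; rewrite /N; apply: truncnS_gt.
have FG k x : (1 + `|x|) / d <= k%:R -> G (N x) x = G k x.
  move=> h; have [le|le] := leqP (N x) k.
    by rewrite -(subnKC le) Gstab.
  by rewrite -(subnKC (ltnW le)) Gstab.
exists (fun x => G (N x) x); split.
- move=> x.
  (* With [2] in place of [1], the bound serves every [y] within distance [1] of [x], so a single
     [G k] is the lift near [x]. *)
  pose k := (Num.truncn ((2 + `|x|) / d)).+1.
  have kP : (2 + `|x|) / d <= k%:R by apply: ltW; apply: truncnS_gt.
  have : \forall y \near x, (1 + `|y|) / d <= k%:R.
    near=> y; apply: le_trans kP; rewrite ler_pM2r ?invr_gt0 //.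
    have : `|x - y| < 1 by near: y; exact: near_dist_lt.
    have := ler_distD x y 0; rewrite !subr0 distrC; lra.
  move=> nk; rewrite /continuous_at (FG k); last exact: nbhs_singleton nk.
  apply: cvg_trans (cG k x); apply: near_eq_cvg.
  by apply: filterS nk => y /FG ->.
- by move=> x; rewrite GP stab.
- elim: (N 0) => // n <-; apply/esym/sep; last first.
    by apply: lt_trans (Gn _ _) _; lra.
  by rewrite !GP !lk0.
Unshelve. all: by end_near. Qed.

End Lifting.

(** * The plane as a covering of the Klein bottle *)

Lemma int_lt1_eq0 (R : realType) (a : int) : `|a%:~R : R| < 1 -> a = 0.
Proof.
rewrite -intr_norm (ltrz1 R) => h; apply/eqP.
by rewrite -normr_eq0 eq_le normr_ge0 andbT -ltzD1 add0r.
Qed.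

Section KleinCovering.
Context (R : realType).
Local Notation R2 := (R * R)%type.
Implicit Types (p q : R2) (g h : ZsZ).

Lemma prod_norm_lt p (e : R) : (`|p| < e) = (`|p.1| < e) && (`|p.2| < e).
Proof. by rewrite prod_normE gt_max. Qed.

Lemma klein_act_isometry g p q : `|klein_act g p - klein_act g q| = `|p - q|.
Proof.
rewrite !prod_normE /= opprD addrACA subrr add0r -mulrBr normrM.
by rewrite opprD addrACA subrr add0r expN1r normrX normrN1 expr1n mul1r.
Qed.

Lemma klein_act_free g p : `|p - klein_act g p| < 1 -> g = 1%g.
Proof.
rewrite prod_norm_lt /= => /andP[h1 h2].
have g2 : g.2 = 0.
  apply: (@int_lt1_eq0 R); move: h2.
  by have -> : p.2 - (g.2%:~R + p.2) = - g.2%:~R by [ring]; rewrite normrN.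
case: g g2 h1 h2 => a b /= -> h1 _; congr pair.
apply: (@int_lt1_eq0 R); move: h1.
rewrite expr0z mul1r.
by have -> : p.1 - (a%:~R + p.1) = - a%:~R by [ring]; rewrite normrN.
Qed.

Lemma klein_pi_act g p : klein_pi (klein_act g p) = klein_pi p.
Proof. by apply/esym/klein_piP; exists g. Qed.

Lemma klein_pi_separated : evenly_separated (@klein_pi R).
Proof.
move=> p q /klein_piP[g ->] /klein_act_free ->; exact/esym/klein_act1.
Qed.

Lemma klein_pi_open (A : set R2) : open A -> open (@klein_pi R @` A).
Proof.
move=> oA; rewrite /open /= /quotient_open openE => x [a Aa /klein_piP[g xg]].
have /nbhs_ballP[e e0 He] : nbhs a A by exact: open_nbhs_nbhs.
apply/nbhs_ballP; exists e => // y xy.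
exists (klein_act g^-1%g y); last exact: klein_pi_act.
apply: He; move: xy; rewrite -!ball_normE /= xg.
by rewrite -(klein_act_isometry g^-1%g) -klein_actM mulVg klein_act1.
Qed.

(** The image of a small ball around one lift of [Phi p] is open. Every other sheet is a deck
    translate of this ball, and deck transformations are isometries, so the same radius works for
    all [q]. *)
Lemma klein_locally_liftable (V : normedModType R) (Phi : V -> klein R) :
  continuous Phi -> locally_liftable (@klein_pi R) Phi.
Proof.
move=> cPhi p e e0; pose q0 := repr (Phi p).
have q0P : klein_pi q0 = Phi p by exact: reprK.
have : nbhs (Phi p) (@klein_pi R @` ball q0 (e / 2)).
  apply: open_nbhs_nbhs; split; first by apply: klein_pi_open; exact: ball_open.
  by exists q0 => //; apply: ballxx; lra.
move=> /cPhi /nbhs_ballP[d /= d0 Hd]; exists d => // p1 p2 h1 h2 q.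
have [|a1 ba1 <-] := Hd p1; first by rewrite -ball_normE.
have [|a2 ba2 <-] := Hd p2; first by rewrite -ball_normE.
move=> /esym/klein_piP[g ->]; exists (klein_act g a2).
  exact: klein_pi_act.
rewrite klein_act_isometry; move: ba1 ba2; rewrite -!ball_normE /= => h3 h4.
by have := ler_distD q0 a1 a2; rewrite (distrC a1 q0); lra.
Qed.

Lemma klein_lift (V : normedModType R) (Phi : V -> klein R) (W : set V) q0 :
  continuous Phi -> compact W ->
  (forall p : V, exists h : V -> V, [/\ W (h p),
     forall x, Phi (h x) = Phi x & forall x y, `|h x - h y| <= `|x - y|]) ->
  klein_pi q0 = Phi 0 ->
  exists F : V -> R2, [/\ continuous F,
    forall x, klein_pi (F x) = Phi x & F 0 = q0].
Proof.
move=> cPhi cW hW q0P; apply: lift_exists q0P.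
- exact: klein_pi_separated.
- exact: klein_locally_liftable.
- by apply: (liftable_uniformly _ cW hW); exact: klein_locally_liftable.
Qed.

Lemma klein_act_continuous g : continuous (@klein_act R g).
Proof.
move=> p; apply/cvgrPdist_lt => e e0; near=> q.
rewrite klein_act_isometry; near: q.
exact: (@near_dist_lt R (R * R)%type p e).
Unshelve. all: by end_near. Qed.

End KleinCovering.

(** * Clamping to the unit interval and rules for continuity *)

Section Clamp.
Context (R : realType).
Implicit Types a b : R.

Definition clampr a : R := ui_val (clamp a).

Lemma clamprE a : clampr a = Num.max 0 (Num.min a 1).
Proof. by rewrite /clampr /ui_val /clamp set_valE. Qed.

Lemma clampr_itv a : 0 <= clampr a <= 1.
Proof. exact: ui_val_itv. Qed.

Lemma clampr_lip a b : `|clampr a - clampr b| <= `|a - b|.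
Proof.
have := ler_norm (a - b); have := lerNnormlW (lexx `|a - b|).
rewrite !clamprE ler_norml.
by case: (leP a 1); case: (leP b 1); case: (leP 0 a); case: (leP 0 b);
  rewrite ?(max_r ler01); lra.
Qed.

Lemma clamp_clampr a : clamp (clampr a) = clamp a.
Proof. exact: clampK. Qed.

Lemma zeroE : zero = clamp (0 : R). Proof. by []. Qed.
Lemma oneE : one = clamp (1 : R). Proof. by []. Qed.

End Clamp.

Section ContinuityCalculus.
Context (R : realType) (T : topologicalType).

Lemma continuous_compose (U V : topologicalType) (f : T -> U) (g : U -> V) :
  continuous f -> continuous g -> continuous (fun x => g (f x)).
Proof. by move=> cf cg x; apply: continuous_comp; [exact: cf|exact: cg]. Qed.

Lemma continuous_fst_comp (U V : topologicalType) (f : T -> U * V) :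
  continuous f -> continuous (fun x => (f x).1).
Proof. by move=> cf; apply: continuous_compose cf _ => x; exact: cvg_fst. Qed.

Lemma continuous_snd_comp (U V : topologicalType) (f : T -> U * V) :
  continuous f -> continuous (fun x => (f x).2).
Proof. by move=> cf; apply: continuous_compose cf _ => x; exact: cvg_snd. Qed.

Lemma continuous_add (f g : T -> R) :
  continuous f -> continuous g -> continuous (fun x => f x + g x).
Proof. by move=> cf cg x; apply: cvgD; [exact: cf|exact: cg]. Qed.

Lemma continuous_opp (f : T -> R) :
  continuous f -> continuous (fun x => - f x).
Proof. by move=> cf x; apply: cvgN; exact: cf. Qed.

Lemma continuous_mul (f g : T -> R) :
  continuous f -> continuous g -> continuous (fun x => f x * g x).
Proof. by move=> cf cg x; apply: cvgM; [exact: cf|exact: cg]. Qed.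

Lemma continuous_const (U : topologicalType) (c : U) :
  continuous (fun _ : T => c).
Proof. by move=> x; exact: cvg_cst. Qed.

Lemma continuous_ident : continuous (fun x : T => x).
Proof. by move=> x; exact: cvg_id. Qed.

End ContinuityCalculus.

Ltac cts := try assumption;
  lazymatch goal with
  | |- forall x, continuous_at x (fun _ => ?c) => exact: continuous_const
  | |- forall x, continuous_at x (fun y => y) => exact: continuous_ident
  | |- forall x, continuous_at x fst => move=> ?; exact: cvg_fst
  | |- forall x, continuous_at x snd => move=> ?; exact: cvg_snd
  | |- forall x, continuous_at x (pair _) => apply: pair_continuous; cts
  | |- forall x, continuous_at x (fun y => pair _ _) =>
      apply: pair_continuous; cts
  | |- forall x, continuous_at x (fun y => fst _) =>
      apply: continuous_fst_comp; cts
  | |- forall x, continuous_at x (fun y => snd _) =>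
      apply: continuous_snd_comp; cts
  | |- forall x, continuous_at x (fun y => @Algebra.add _ _ _) =>
      apply: continuous_add; cts
  | |- forall x, continuous_at x (fun y => @Algebra.opp _ _) =>
      apply: continuous_opp; cts
  | |- forall x, continuous_at x (@GRing.mul _ _) =>
      apply: continuous_mul; cts
  | |- forall x, continuous_at x (fun y => @GRing.mul _ _ _) =>
      apply: continuous_mul; cts
  | |- _ => idtac
  end.

(** * The plane as a covering of the torus, and lifts of homotopies *)

Section TorusCovering.
Context (R : realType).
Local Notation R2 := (R * R)%type.
Local Notation I := (unit_interval R).
Implicit Types (p q : R2).

Lemma torus_pi_shift v p : torus_pi (torus_shift v p) = torus_pi p.
Proof. by apply/esym/torus_piP; exists v. Qed.

Lemma torus_shift_dist v p q : `|torus_shift v p - torus_shift v q| = `|p - q|.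
Proof. by rewrite !prod_normE /= !opprD !(addrACA _ (_%:~R)) !subrr !addr0. Qed.

Lemma torus_shift_continuous v : continuous (@torus_shift R v).
Proof. by rewrite /torus_shift; cts. Qed.

Lemma torus_pi_open (A : set R2) : open A -> open (@torus_pi R @` A).
Proof.
move=> oA; rewrite /open /= /quotient_open openE => x [a Aa /torus_piP[v xv]].
have /nbhs_ballP[e e0 He] : nbhs a A by exact: open_nbhs_nbhs.
have xE : a = torus_shift (- v) x.
  by case: a xv {Aa He} => a1 a2 ->; rewrite /torus_shift /= !mulrNz !addrK.
apply/nbhs_ballP; exists e => // y xy.
exists (torus_shift (- v) y); last exact: torus_pi_shift.
by apply: He; move: xy; rewrite -!ball_normE /= xE torus_shift_dist.
Qed.

(** A product of a quotient map with an identity need not be a quotient map in general; here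
    [torus_pi] is open, so it sends product neighbourhoods to product neighbourhoods. *)
Lemma continuous_torus_homotopy (N : topologicalType) (H : I * torus R -> N) :
  continuous (fun z : I * R2 => H (z.1, torus_pi z.2)) -> continuous H.
Proof.
move=> cH [s x]; rewrite -[x]reprK -/(torus_pi (repr x)) => U HU.
have [[/= A B] [As Bp] AB] := cH (s, repr x) U HU.
exists (A, @torus_pi R @` B); first split => //=.
  move: Bp => /nbhs_ballP[e /= e0 He].
  apply: (@filterS _ _ _ (@torus_pi R @` ball (repr x) e)).
    by move=> _ [y /He By <-]; exists y.
  apply: open_nbhs_nbhs; split; first by apply: torus_pi_open; exact: ball_open.
  by exists (repr x) => //; exact: ballxx.
by move=> [t _] [/= At [y By <-]]; exact: (AB (t, y)).
Qed.

(* The time variable is extended from the unit interval to [R] by clamping, so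
   that the domain of the lift is a normed space. *)
Lemma torus_homotopy_lift (H : I * torus R -> klein R) (q0 : R2) :
  continuous H -> klein_pi q0 = H (zero, torus_base R) ->
  exists F : R * R2 -> R2, [/\ continuous F,
    forall s p, klein_pi (F (s, p)) = H (clamp s, torus_pi p) &
    F (0, (0, 0)) = q0].
Proof.
move=> cH q0P.
pose Phi (z : R * R2) := H (clamp z.1, torus_pi z.2).
have cPhi : continuous Phi.
  apply: (continuous_compose _ cH); apply: pair_continuous.
    by apply: (continuous_compose _ (@clamp_continuous R)); cts.
  by apply: (continuous_compose _ (@torus_pi_continuous R)); cts.
pose J : set R := `[0, 1]%classic.
have cJ : compact J by exact: segment_compact.
have [|||F [cF FP F0]] :=
  @klein_lift R (R * R2)%type Phi (J `*` (J `*` J)) q0 cPhi.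
- by apply: compact_setX => //; apply: compact_setX.
- move=> [s [x y]].
  (* This lattice translation brings [(x, y)] into the unit square. *)
  pose v : int * int := (- Num.floor x, - Num.floor y).
  exists (fun z => (clampr z.1, torus_shift v z.2)); split.
  + have fl (r : R) : J (r + (- Num.floor r)%:~R).
      rewrite /J /= in_itv /= mulrNz.
      by have := floor_le r; have := floorD1_gt r; rewrite intrD; lra.
    split => /=; last by split; exact: fl.
    by rewrite /J /= in_itv /=; exact: clampr_itv.
  + by move=> z; rewrite /Phi /= clamp_clampr torus_pi_shift.
  + move=> z w; rewrite prod_normE [`|z - w|]prod_normE /=.
    rewrite ge_max; apply/andP; split; rewrite le_max; apply/orP.
      by left; exact: clampr_lip.
    by right; rewrite torus_shift_dist.
- exact: q0P.
- by exists F; split => // s p; rewrite FP.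
Qed.

End TorusCovering.

(** * Lifts of loops and of their homotopies *)

Section LoopLifting.
Context (R : realType).
Local Notation R2 := (R * R)%type.
Local Notation I := (unit_interval R).

Lemma lifts_differ_by_deck (V : normedModType R) (F F' : V -> R2) :
  continuous F -> continuous F' ->
  (forall x, klein_pi (F x) = klein_pi (F' x)) ->
  exists g, forall x, F' x = klein_act g (F x).
Proof.
move=> cF cF' FF'; have /klein_piP[g gP] := FF' 0; exists g.
apply: (lift_unique (@klein_pi_separated R) cF' _ _ gP).
  by apply: (continuous_compose cF); exact: klein_act_continuous.
by move=> x; rewrite klein_pi_act.
Qed.

Lemma square_lift (H : I * I -> klein R) (q0 : R2) :
  continuous H -> klein_pi q0 = H (zero, zero) ->
  exists F : R2 -> R2, [/\ continuous F,
    forall s t, klein_pi (F (s, t)) = H (clamp s, clamp t) & F (0, 0) = q0].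
Proof.
move=> cH q0P.
pose Phi (z : R2) := H (clamp z.1, clamp z.2).
have cPhi : continuous Phi.
  apply: (continuous_compose _ cH); apply: pair_continuous;
  by apply: (continuous_compose _ (@clamp_continuous R)); cts.
pose J : set R := `[0, 1]%classic.
have cJ : compact J by exact: segment_compact.
have [|||F [cF FP F0]] := @klein_lift R R2 Phi (J `*` J) q0 cPhi.
- exact: compact_setX.
- move=> p; exists (fun z => (clampr z.1, clampr z.2)); split.
  + by split; rewrite /J /= in_itv /=; exact: clampr_itv.
  + by move=> z; rewrite /Phi /= !clamp_clampr.
  + move=> z w; rewrite prod_normE [`|z - w|]prod_normE /=.
    by rewrite ge_max; apply/andP; split; rewrite le_max; apply/orP;
       [left|right]; exact: clampr_lip.
- exact: q0P.
- by exists F; split => // s t; rewrite FP.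
Qed.

(** The homotopy fixes end points, so its lift to the square is constant on the sides [t = 0] and
    [t = 1]; by uniqueness the sides [s = 0] and [s = 1] are [a] and [a']. *)
Lemma homotopic_loops_lift_end (k : klein R) (l l' : loop R k)
    (a a' : R -> R2) :
  \pi_(pi1 R k) l = \pi_(pi1 R k) l' :> pi1 R k ->
  continuous a -> continuous a' ->
  (forall t, klein_pi (a t) = l (clamp t)) ->
  (forall t, klein_pi (a' t) = l' (clamp t)) ->
  a 0 = a' 0 -> a 1 = a' 1.
Proof.
move=> /eqmodP /asboolP[H [H0 H1 Hrel]] ca ca' aP a'P e.
have [||F [cF FP F0]] := @square_lift H (a 0).
- exact: cts_fun.
- by rewrite aP H0.
have sep := @klein_pi_separated R.
have cl (t : R) : continuous (fun s => F (s, t)).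
  by apply: (continuous_compose _ cF); cts.
have cr (s : R) : continuous (fun t => F (s, t)).
  by apply: (continuous_compose _ cF); cts.
have bottom (s : R) : F (s, 0) = a 0.
  apply: (lift_unique sep (cl 0) (@continuous_const _ _ (a 0)) _ F0) => {}s.
  by rewrite FP aP Hrel //; left.
have left_ (t : R) : F (0, t) = a t.
  by apply: (lift_unique sep (cr 0) ca _ F0) => {}t; rewrite FP aP H0.
have right_ (t : R) : F (1, t) = a' t.
  apply: (lift_unique sep (cr 1) ca' _ (etrans (bottom 1) e)) => {}t.
  by rewrite FP a'P H1.
rewrite -left_ -right_.
apply: (lift_unique sep (@continuous_const _ _ (F (0, 1))) (cl 1)) => // s.
by rewrite !FP !Hrel //; right.
Qed.

End LoopLifting.

(** * Equivariant lifts and the reformulated Borsuk-Ulam property *)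

Section Equivariance.
Context (R : realType).
Local Notation R2 := (R * R)%type.
Local Notation I := (unit_interval R).
Implicit Types (phi : int * int -> ZsZ) (F : R2 -> R2).

Definition equivariant phi F : Prop :=
  forall v p, F (torus_shift v p) = klein_act (phi v) (F p).

Definition covers F (f : torus R -> klein R) : Prop :=
  forall p, klein_pi (F p) = f (torus_pi p).

Lemma pointed_map_lift (f : continuousType (torus R) (klein R)) (q0 : R2) :
  f (torus_base R) = klein_pi q0 ->
  exists F, [/\ continuous F, covers F f & F (0, 0) = q0].
Proof.
move=> fb; have [||F [cF FP F0]] := @torus_homotopy_lift R (fun z => f z.2) q0.
- by apply: continuous_compose cts_fun; cts.
- by rewrite fb.
exists (fun p => F (0, p)); split => [|p|]; last exact: F0; last by rewrite FP.
by apply: (continuous_compose _ cF); cts.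
Qed.

Lemma beta_sharp_lift (beta : homotopy_class R (torus R) (klein R)) phi :
  beta_sharp beta phi ->
  exists (f : continuousType (torus R) (klein R)) F,
    [/\ represents f beta, continuous F, covers F f & equivariant phi F].
Proof.
move=> [_ _ [f [fb [g [fbeta fphi]]]]].
have [F [cF Ff F0]] := pointed_map_lift fb.
have Feq v p : F (torus_shift v p) = klein_act (phi v ^ g)%g (F p).
  have [|||h hP] := @lifts_differ_by_deck R R2 F (fun p => F (torus_shift v p)).
  - exact: cF.
  - by apply: (continuous_compose _ cF); exact: torus_shift_continuous.
  - by move=> x; rewrite !Ff torus_pi_shift.
  rewrite hP; congr klein_act.
  (* The segment to [k] and the image under [F] of the segment to [v] start at the origin and lift
     homotopic loops, so they end at the same point. This end point determines [h]. *)
  have := fphi v; rewrite pi1_mapE => /esym.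
  set k := (phi v ^ g)%g => kP.
  pose line (w : int * int) (t : R) : R2 := segment w (clamp t).
  have cline w : continuous (line w).
    apply: (continuous_compose (@clamp_continuous R)).
    exact: segment_continuous.
  have := homotopic_loops_lift_end kP (cline k)
    (continuous_compose (cline v) cF).
  rewrite /line -zeroE -oneE !segment0 !segment1 F0.
  have -> : (v.1%:~R, v.2%:~R) = torus_shift v (0, 0) :> R2.
    by rewrite /torus_shift /= !add0r.
  rewrite hP F0 /klein_act /= mulr0 !addr0 => E.
  have [] : (k.1%:~R, k.2%:~R) = (h.1%:~R, h.2%:~R) :> R2.
    by apply: E => // t; rewrite Ff.
  move=> /intr_inj e1 /intr_inj e2.
  exact: (injective_projections h k (esym e1) (esym e2)).
(* Applying [g] to the lift undoes the conjugation of [phi] by [g]. *)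
exists f, (fun p => klein_act g (F p)); split => //.
- by apply: (continuous_compose cF); exact: klein_act_continuous.
- by move=> p; rewrite klein_pi_act.
- by move=> v p; rewrite Feq -!klein_actM conjgE !mulgA mulgV mul1g.
Qed.

(** A free homotopy from [f0] to [f] is lifted with initial stage [F0]. Equivariance equates two
    lifts of one map, so uniqueness carries it from time [0] to time [1]. *)
Lemma representative_lift (beta : homotopy_class R (torus R) (klein R)) phi
    (f0 f : continuousType (torus R) (klein R)) F0 :
  represents f0 beta -> represents f beta -> continuous F0 -> covers F0 f0 ->
  equivariant phi F0 ->
  exists F, [/\ continuous F, covers F f & equivariant phi F].
Proof.
move=> <- /esym /eqmodP /asboolP[H [H0 H1 _]] cF0 F0f eF0.
have [||F [cF FP F00]] := @torus_homotopy_lift R H (F0 (0, 0)).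
- exact: cts_fun.
- by rewrite F0f H0.
have cs (s : R) : continuous (fun p => F (s, p)).
  by apply: (continuous_compose _ cF); cts.
have Fs0 (p : R2) : F (0, p) = F0 p.
  apply: (lift_unique (@klein_pi_separated R) (cs 0) cF0 _ F00) => {}p.
  by rewrite FP F0f H0.
exists (fun p => F (1, p)); split => // [p|v p].
  by rewrite FP H1.
apply: (@lift_unique R (R * R2)%type _ _ _ (fun z => F (z.1, torus_shift v z.2))
  (fun z => klein_act (phi v) (F z)) (0, (0, 0)) (@klein_pi_separated R)
  _ _ _ _ (1, p)).
- apply: (continuous_compose _ cF); apply: pair_continuous; first by cts.
  by apply: (continuous_compose _ (@torus_shift_continuous R v)); cts.
- by apply: (continuous_compose cF); exact: klein_act_continuous.
- by move=> [s x]; rewrite klein_pi_act !FP torus_pi_shift.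
- by rewrite /= !Fs0 eF0.
Qed.

Lemma klein_act_convex g (s : R) (p q : R2) :
  klein_act g ((1 - s) * p.1 + s * q.1, (1 - s) * p.2 + s * q.2) =
  ((1 - s) * (klein_act g p).1 + s * (klein_act g q).1,
   (1 - s) * (klein_act g p).2 + s * (klein_act g q).2).
Proof. by rewrite /klein_act /=; congr pair; ring. Qed.

(** The straight-line homotopy from [F0] to [F] is equivariant by [klein_act_convex], so it descends
    to a homotopy that starts at [f0]. *)
Lemma equivariant_map (beta : homotopy_class R (torus R) (klein R)) phi
    (f0 : continuousType (torus R) (klein R)) F0 F :
  represents f0 beta -> continuous F0 -> covers F0 f0 -> equivariant phi F0 ->
  continuous F -> equivariant phi F ->
  exists2 f : continuousType (torus R) (klein R),
    represents f beta & covers F f.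
Proof.
move=> <- cF0 F0f eF0 cF eF.
pose K (s : R) (p : R2) : R2 :=
  ((1 - s) * (F0 p).1 + s * (F p).1, (1 - s) * (F0 p).2 + s * (F p).2).
have Keq s : equivariant phi (K s).
  by move=> v p; rewrite /K eF0 eF klein_act_convex.
pose H (z : I * torus R) : klein R := klein_pi (K (ui_val z.1) (repr z.2)).
have HP s p : H (s, torus_pi p) = klein_pi (K (ui_val s) p).
  rewrite /H /=; have := reprK (torus_pi p).
  rewrite -/(torus_pi _) => /esym/torus_piP[v ->].
  by rewrite Keq klein_pi_act.
have cH : continuous H.
  apply: continuous_torus_homotopy.
  have -> : (fun z => H (z.1, torus_pi z.2)) =
      fun z : I * R2 => klein_pi (K (ui_val z.1) z.2).
    by apply/funext => z; rewrite HP.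
  apply: (continuous_compose _ (@klein_pi_continuous R)).
  have cu : continuous (fun z : I * R2 => ui_val z.1).
    by apply: (continuous_compose _ (@ui_val_continuous R)); cts.
  have cF0' : continuous (fun z : I * R2 => F0 z.2).
    by apply: (continuous_compose _ cF0); cts.
  have cF' : continuous (fun z : I * R2 => F z.2).
    by apply: (continuous_compose _ cF); cts.
  by rewrite /K /=; cts.
have cf : continuous (fun x => H (one, x)).
  by apply: (continuous_compose _ cH); cts.
exists (mkcts cf).
  apply/esym/eqmodP/asboolP; exists (mkcts cH); split => // x.
  rewrite -[LHS]/(klein_pi (K (ui_val zero) (repr x))) ui_val0 /K subr0 !mul1r.
  rewrite !mul0r !addr0.
  by rewrite -surjective_pairing (F0f (repr x)) /torus_pi reprK.
move=> p; rewrite -[RHS]/(H (one, torus_pi p)) HP ui_val1 /K.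
by rewrite subrr !mul1r !mul0r !add0r -surjective_pairing.
Qed.

Lemma borsuk_ulam_equivariant
    (beta : homotopy_class R (torus R) (klein R)) phi :
  beta_sharp beta phi ->
  borsuk_ulam (tau1 R) beta <->
  (forall F, continuous F -> equivariant phi F ->
     exists p g, F (p.1 + 2^-1, p.2) = klein_act g (F p)).
Proof.
move=> /beta_sharp_lift[f0 [F0 [f0beta cF0 F0f eF0]]]; split.
  move=> bu F cF eF.
  have [f fbeta Ff] := equivariant_map f0beta cF0 F0f eF0 cF eF.
  have [x] := bu f fbeta.
  rewrite -[x]reprK -/(torus_pi (repr x)) /= tau1_funE -!Ff.
  by move=> /esym/klein_piP[g gP]; exists (repr x), g.
move=> h f fbeta.
have [F [cF Ff eF]] := representative_lift f0beta fbeta cF0 F0f eF0.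
have [p [g gP]] := h F cF eF.
exists (torus_pi p); rewrite /= tau1_funE -!Ff /tau1_lift gP.
exact: klein_pi_act.
Qed.

End Equivariance.

(** * The sine with integer zeros, and the line as a covering of the circle *)

Section Trigonometry.
Context (R : realType).
Implicit Types (x t : R).

Definition sn x : R := sin (pi * x).

Lemma sn_continuous : continuous sn.
Proof.
apply: (continuous_compose _ (@continuous_sin R)).
by cts.
Qed.

Lemma snD_int x (z : int) : sn (x + z%:~R) = (-1) ^ z * sn x.
Proof.
have nat_case (n : nat) y : sn (y + n%:R) = (-1) ^+ n * sn y.
  rewrite /sn mulrDr mulr_natr; exact: (alternatingn (@sinDpi R)).
case: z => n; first exact: nat_case.
rewrite NegzE expN1r abszN /=.
have := nat_case n.+1 (x + (- n.+1%:Z)%:~R).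
rewrite mulrNz -!pmulrn subrK => ->.
by rewrite mulrA -expr2 sqrr_sign mul1r.
Qed.

Lemma sn_eq0 x : sn x = 0 -> exists z : int, x = z%:~R.
Proof.
move=> sx; exists (Num.floor x).
set k := Num.floor x; pose r := x + (- k)%:~R.
have sr : sn r = 0 by rewrite /r snD_int sx mulr0.
have r0 : 0 <= r by rewrite /r mulrNz subr_ge0 floor_le.
have r1 : r < 1 by rewrite /r mulrNz ltrBlDr addrC -(intrD _ k 1) floorD1_gt.
suff : r = 0 by rewrite /r mulrNz => /eqP; rewrite subr_eq0 => /eqP.
apply/eqP; rewrite eq_le r0 andbT leNgt; apply/negP => rp.
have : 0 < sn r.
  apply: sin_gt0_pi; rewrite mulr_gt0 ?pi_gt0 //=.
  by rewrite -[ltRHS]mulr1 ltr_pM2l ?pi_gt0.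
by rewrite sr ltxx.
Qed.

Lemma sn_half : sn 2^-1 = 1.
Proof. exact: sin_pihalf. Qed.

Lemma sn_bound x : `|sn x| <= 1.
Proof. exact: sin_max. Qed.

Definition circle t : R * R := (cos t, sin t).

Lemma circle_eq t t' : circle t = circle t' -> cos (t - t') = 1.
Proof. by move=> [c s]; rewrite cosB c s -!expr2 cos2Dsin2. Qed.

Lemma circle_separated : evenly_separated circle.
Proof.
move=> t t' /circle_eq c1 lt1.
have : cos `|t - t'| = cos 0 by rewrite cos_norm c1 cos0.
move/(@cos_inj R); rewrite !in_itv /= normr_ge0 lexx pi_ge0 /=.
have -> : `|t - t'| <= pi by have := pi_ge2 R; lra.
by move=> /(_ isT isT) /eqP; rewrite normr_eq0 subr_eq0 => /eqP.
Qed.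

Lemma circle_surj x y : x ^+ 2 + y ^+ 2 = 1 -> exists t, circle t = (x, y).
Proof.
move=> xy.
have x1 : (-1 <= x) && (x <= 1).
  have y2 := sqr_ge0 y; apply/andP; split; nra.
have sa : Num.sqrt (1 - x ^+ 2) = `|y|.
  by rewrite -xy addrC addKr sqrtr_sqr.
have [y0|y0] := leP 0 y.
  exists (acos x); rewrite /circle acosK ?in_itv // sin_acos // sa ger0_norm //.
exists (- acos x); rewrite /circle cosN sinN acosK ?in_itv // sin_acos // sa.
by rewrite ltr0_norm // opprK.
Qed.

(* The quotient is the tangent of the oriented angle from [(x, y)] to
   [(x', y')]. *)
Lemma circle_rotate t (x y x' y' : R) :
  circle t = (x, y) -> x' ^+ 2 + y' ^+ 2 = 1 -> 0 < x * x' + y * y' ->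
  circle (t + atan ((x * y' - y * x') / (x * x' + y * y'))) = (x', y').
Proof.
move=> [cx sy] xy' d0.
have xy : x ^+ 2 + y ^+ 2 = 1 by rewrite -cx -sy cos2Dsin2.
set d := x * x' + y * y' in d0 *; set c := x * y' - y * x'.
have dc : d ^+ 2 + c ^+ 2 = 1.
  have -> : d ^+ 2 + c ^+ 2 = (x ^+ 2 + y ^+ 2) * (x' ^+ 2 + y' ^+ 2).
    by rewrite /d /c; ring.
  by rewrite xy xy' mulr1.
have ca : cos (atan (c / d)) = d.
  rewrite cos_atan; have -> : 1 + (c / d) ^+ 2 = (d^-1) ^+ 2.
    transitivity ((d ^+ 2 + c ^+ 2) / d ^+ 2); last by rewrite dc div1r exprVn.
    by field; rewrite gt_eqF.
  by rewrite sqrtr_sqr ger0_norm ?invrK // invr_ge0 ltW.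
have sa : sin (atan (c / d)) = c.
  have := atanK (c / d); rewrite /tan ca => /(congr1 ( *%R^~ d)).
  by rewrite !divfK ?gt_eqF.
rewrite /circle cosD sinD ca sa cx sy /d /c; congr pair.
  by transitivity ((x ^+ 2 + y ^+ 2) * x'); [ring | rewrite xy mul1r].
by transitivity ((x ^+ 2 + y ^+ 2) * y'); [ring | rewrite xy mul1r].
Qed.

(** The oriented angle from the value at [p1] to the value at [p2] is continuous near [(p, p)],
    where it is [0]. Adding it to an angle at [p1] gives a nearby angle at [p2]. *)
Lemma circle_locally_liftable (V : normedModType R) (X Y : V -> R) :
  continuous X -> continuous Y -> (forall p, X p ^+ 2 + Y p ^+ 2 = 1) ->
  locally_liftable circle (fun p => (X p, Y p)).
Proof.
move=> cX cY XY p e e0.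
pose d (z : V * V) := X z.1 * X z.2 + Y z.1 * Y z.2.
pose c (z : V * V) := X z.1 * Y z.2 - Y z.1 * X z.2.
have cX1 : continuous (fun z : V * V => X z.1).
  by apply: (continuous_compose _ cX); cts.
have cX2 : continuous (fun z : V * V => X z.2).
  by apply: (continuous_compose _ cX); cts.
have cY1 : continuous (fun z : V * V => Y z.1).
  by apply: (continuous_compose _ cY); cts.
have cY2 : continuous (fun z : V * V => Y z.2).
  by apply: (continuous_compose _ cY); cts.
have cd : continuous d by rewrite /d; cts.
have cc : continuous c by rewrite /c; cts.
have d1 : d (p, p) = 1 by rewrite /d /= -!expr2.
have c0 : c (p, p) = 0 by rewrite /c /= mulrC subrr.
have ca : {for (p, p), continuous (fun z => atan (c z / d z))}.
  apply: (@continuous_comp _ _ _ (fun z => c z / d z) atan).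
    apply: cvgM; first exact: cc.
    by apply: cvgV; [rewrite d1 oner_neq0 | exact: cd].
  exact: continuous_atan.
have : \forall z \near (p, p), 0 < d z /\ `|atan (c z / d z)| < e.
  near=> z; split.
    by near: z; apply: (cvgr_gt (d (p, p)) (cd (p, p))); rewrite d1.
  near: z; move/cvgrPdist_lt: ca => /(_ e e0).
  by apply: filterS => z; rewrite c0 mul0r atan0 sub0r normrN.
move=> /nbhs_ballP[r /= r0 Hr]; exists r => // p1 p2 h1 h2 t tP.
have [|dpos small] := Hr (p1, p2).
  by split; rewrite -ball_normE.
exists (t + atan (c (p1, p2) / d (p1, p2))).
  exact: circle_rotate.
by rewrite opprD addrA subrr add0r normrN.
Unshelve. all: by end_near. Qed.

End Trigonometry.

(** * Common zeros of two antiperiodic functions *)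

Section CommonZero.
Context (R : realType).
Local Notation R2 := (R * R)%type.
Implicit Types (p : R2) (D E X Y : R2 -> R).

Lemma lattice_ind (Q : int * int -> Prop) :
  Q (1, 0) -> Q (0, 1) -> (forall u v, Q u -> Q v -> Q (u + v)) ->
  (forall u, Q u -> Q (- u)) -> forall v, Q v.
Proof.
move=> Q1 Q2 QD QN.
have Qn u (n : nat) : Q u -> Q (u *+ n).
  move=> Qu; elim: n => [|n IH].
    by rewrite mulr0n -(subrr u); exact/QD/QN.
  by rewrite mulrS; exact: QD.
have Qz u (z : int) : Q u -> Q (u *~ z).
  by move=> Qu; case: z => n; [exact: Qn | rewrite NegzE mulrNz; exact/QN/Qn].
move=> [m n]; suff -> : (m, n) = (1, 0) *~ m + (0, 1) *~ n.
  by apply: QD; exact: Qz.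
have fstz (u : int * int) (k : int) : (u *~ k).1 = u.1 *~ k.
  exact: (raddfMz (@fst int int)).
have sndz (u : int * int) (k : int) : (u *~ k).2 = u.2 *~ k.
  exact: (raddfMz (@snd int int)).
apply: injective_projections; rewrite /= ?fstz ?sndz /= ?intz ?mul0rz.
  by rewrite addr0.
by rewrite add0r.
Qed.

Lemma torus_shiftD u v p :
  torus_shift (u + v) p = torus_shift u (torus_shift v p).
Proof. by rewrite /torus_shift /=; congr pair; rewrite intrD; ring. Qed.

Lemma torus_shiftN v p : torus_shift (- v) (torus_shift v p) = p.
Proof. by case: p => x y; rewrite /torus_shift /= !mulrNz !addrK. Qed.

Lemma circle_lift X Y :
  continuous X -> continuous Y -> (forall p, X p ^+ 2 + Y p ^+ 2 = 1) ->
  (forall v p, X (torus_shift (v + v) p) = X p) ->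
  (forall v p, Y (torus_shift (v + v) p) = Y p) ->
  exists2 theta : R2 -> R, continuous theta &
    forall p, circle (theta p) = (X p, Y p).
Proof.
move=> cX cY XY pX pY.
pose J : set R := `[0, 2]%classic.
have cJ : compact J by exact: segment_compact.
have ll := circle_locally_liftable cX cY XY.
have [t0 t0P] := circle_surj (XY 0).
have [|theta [ct tP _]] := lift_exists (@circle_separated R) ll _ t0P.
  apply: (liftable_uniformly ll (compact_setX cJ cJ)) => -[x y].
  (* Only even translations are known to preserve [X] and [Y]; hence the square of side [2] and the
     floors of halves. *)
  pose v : int * int := (- Num.floor (x / 2), - Num.floor (y / 2)).
  exists (torus_shift (v + v)); split.
  - have fl (r : R) : J (r + (- Num.floor (r / 2) - Num.floor (r / 2))%:~R).
      rewrite /J /= in_itv /= intrD mulrNz.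
      have := floor_le (r / 2); have := floorD1_gt (r / 2).
      by rewrite intrD; lra.
    by split; exact: fl.
  - by move=> p; rewrite pX pY.
  - by move=> p q; rewrite torus_shift_dist.
by exists theta.
Qed.

Lemma antiperiodic_common_zero D E :
  continuous D -> continuous E ->
  (forall x y, D (x + 1, y) = - D (x, y)) ->
  (forall x y, D (x, y + 1) = D (x, y)) ->
  (forall x y, E (x + 1, y) = E (x, y)) ->
  (forall x y, E (x, y + 1) = - E (x, y)) ->
  exists p, D p = 0 /\ E p = 0.
Proof.
move=> cD cE D1 D2 E1 E2; apply: contrapT => no0.
pose n p := Num.sqrt (D p ^+ 2 + E p ^+ 2).
have n0 p : 0 < n p.
  rewrite sqrtr_gt0 lt_neqAle addr_ge0 ?sqr_ge0 // andbT eq_sym.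
  apply/negP; rewrite paddr_eq0 ?sqr_ge0 // !sqrf_eq0 => /andP[/eqP d /eqP e].
  by apply: no0; exists p.
have cn : continuous n.
  apply: (continuous_compose _ (@sqrt_continuous R)).
  by change (continuous (fun p => D p * D p + E p * E p)); cts.
have n1 x y : n (x + 1, y) = n (x, y) by rewrite /n D1 E1 sqrrN.
have n2 x y : n (x, y + 1) = n (x, y) by rewrite /n D2 E2 sqrrN.
pose X p := D p / n p; pose Y p := E p / n p.
have cdiv (f : R2 -> R) : continuous f -> continuous (fun p => f p / n p).
  move=> cf p; apply: cvgM; first exact: cf.
  by apply: cvgV; [rewrite gt_eqF | exact: cn].
have XY p : X p ^+ 2 + Y p ^+ 2 = 1.
  rewrite /X /Y !exprMn -mulrDl exprVn.
  rewrite -[X in X / _]sqr_sqrtr ?addr_ge0 ?sqr_ge0 // -/(n p) divff //.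
  by rewrite expf_neq0 // gt_eqF.
have X1 x y : X (x + 1, y) = - X (x, y) by rewrite /X D1 n1 mulNr.
have X2 x y : X (x, y + 1) = X (x, y) by rewrite /X D2 n2.
have Y1 x y : Y (x + 1, y) = Y (x, y) by rewrite /Y E1 n1.
have Y2 x y : Y (x, y + 1) = - Y (x, y) by rewrite /Y E2 n2 mulNr.
have per (Z : R2 -> R) :
    (forall x y, Z (x + 1 + 1, y) = Z (x, y)) ->
    (forall x y, Z (x, y + 1 + 1) = Z (x, y)) ->
    forall v p, Z (torus_shift (v + v) p) = Z p.
  move=> Z1 Z2; elim/lattice_ind => [[x y]|[x y]|u v IHu IHv p|u IH p].
  - by rewrite /torus_shift /= !addr0 -[RHS]Z1 intrD addrA.
  - by rewrite /torus_shift /= !addr0 -[RHS]Z2 intrD addrA.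
  - by rewrite addrACA torus_shiftD IHu IHv.
  - by rewrite -opprD -[LHS]IH -{1}[u + u]opprK torus_shiftN.
have [||theta ct tP] := circle_lift (cdiv _ cD) (cdiv _ cE) XY.
- by apply: per => x y; rewrite -/(X _) -/(X _) ?X1 ?X2 ?opprK // X2.
- by apply: per => x y; rewrite -/(Y _) -/(Y _) ?Y1 ?Y2 ?opprK // Y1.
have cosE p : cos (theta p) = X p by case: (tP p).
have sinE p : sin (theta p) = Y p by case: (tP p).
(* Such an [h] has values in the discrete set of multiples of [2 * pi]; it and the constant [h 0]
   lift the same map to the circle. *)
have const (h : R2 -> R) : continuous h -> (forall p, cos (h p) = 1) ->
    forall p, h p = h 0.
  move=> ch hc p; have hs q : sin (h q) = 0.
    by apply: cos1sin0; rewrite hc normr1.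
  apply: (lift_unique (@circle_separated R) ch
    (@continuous_const _ _ (h 0)) _ (erefl _)).
  by move=> q; rewrite /circle !hc !hs.
(* On angles, changing the sign of the cosine is [t -> pi - t] and changing that of the sine is
   [t -> - t], up to multiples of [2 * pi]. *)
pose h1 p := theta (p.1 + 1, p.2) + theta p - pi.
pose h2 p := theta (p.1, p.2 + 1) + theta p.
have ch1 : continuous h1.
  have : continuous (fun p => theta (p.1 + 1, p.2)).
    by apply: (continuous_compose _ ct); cts.
  by move=> ct'; rewrite /h1; cts.
have ch2 : continuous h2.
  have : continuous (fun p => theta (p.1, p.2 + 1)).
    by apply: (continuous_compose _ ct); cts.
  by move=> ct'; rewrite /h2; cts.
have hc1 p : cos (h1 p) = 1.
  rewrite /h1 cosB cospi sinpi mulr0 addr0 mulrN1 cosD !cosE !sinE X1 Y1.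
  by case: p => x y; rewrite -(XY (x, y)) /=; ring.
have hc2 p : cos (h2 p) = 1.
  rewrite /h2 cosD !cosE !sinE X2 Y2.
  by case: p => x y; rewrite -(XY (x, y)) /=; ring.
have k1 := const _ ch1 hc1; have k2 := const _ ch2 hc2.
(* The sum of [theta] over the corners of the unit square is [2 * (h1 0 + pi)] along horizontal
   edges and [2 * h2 0] along vertical ones. *)
have e : h2 0 - h1 0 = pi.
  have a1 := k1 (0, 0); have a2 := k1 (0, 1).
  have b1 := k2 (0, 0); have b2 := k2 (1, 0).
  by move: a1 a2 b1 b2; rewrite /h1 /h2 /= !add0r; lra.
have : cos (h2 0 - h1 0) = 1.
  have s1 : sin (h1 0) = 0 by apply: cos1sin0; rewrite hc1 normr1.
  by rewrite cosB hc1 hc2 s1 mulr0 addr0 mulr1.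
by rewrite e cospi; lra.
Qed.

Lemma half_antiperiodic_common_zero D E :
  continuous D -> continuous E ->
  (forall x y, D (x + 2^-1, y) = - D (x, y)) ->
  (forall x y, D (x, y + 1) = D (x, y)) ->
  (forall x y, E (x + 2^-1, y) = E (x, y)) \/
  (forall x y, E (x + 2^-1, y) = - E (x, y)) ->
  (forall x y, E (x, y + 1) = - E (x, y)) ->
  exists p, D p = 0 /\ E p = 0.
Proof.
move=> cD cE D1 D2 E1 E2; have halfD x : (x + 1) / 2 = x / 2 + 2^-1 :> R by lra.
case: E1 => E1.
  have [||||||p [Dp Ep]] := @antiperiodic_common_zero
      (fun p => D (p.1 / 2, p.2)) (fun p => E (p.1 / 2, p.2)).
  - by apply: (continuous_compose _ cD); cts.
  - by apply: (continuous_compose _ cE); cts.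
  - by move=> x y /=; rewrite halfD D1.
  - by move=> x y /=; rewrite D2.
  - by move=> x y /=; rewrite halfD E1.
  - by move=> x y /=; rewrite E2.
  - by exists (p.1 / 2, p.2).
(* The shear [y + x] turns an odd [E] into an even one. *)
have [||||||p [Dp Ep]] := @antiperiodic_common_zero
    (fun p => D (p.1 / 2, p.2 + p.1)) (fun p => E (p.1 / 2, p.2 + p.1)).
- by apply: (continuous_compose _ cD); cts.
- by apply: (continuous_compose _ cE); cts.
- by move=> x y /=; rewrite halfD addrA D1 D2.
- by move=> x y /=; rewrite addrAC D2.
- by move=> x y /=; rewrite halfD addrA E1 E2 opprK.
- by move=> x y /=; rewrite addrAC E2.
- by exists (p.1 / 2, p.2 + p.1).
Qed.

End CommonZero.

(** * Parity and 2-adic valuation of integers *)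

Section Parity.

Lemma signz_even (R : realType) (m : int) : (-1 : R) ^ (2 * m) = 1.
Proof. by rewrite -exprz_exp -[X in X ^ m]/((-1) ^+ 2) sqrrN expr1n exp1rz. Qed.

Lemma signz_odd (R : realType) (m : int) : (-1 : R) ^ (2 * m + 1) = -1.
Proof. by rewrite exprzDr ?unitrN1 // signz_even mul1r. Qed.

Lemma int_parity (m : int) :
  if odd `|m|%N then exists k, m = 2 * k + 1 else exists k, m = 2 * k.
Proof.
have e : m = 2 * (m %/ 2)%Z + (m %% 2)%Z by rewrite mulrC -divz_eq.
have b : (0 <= m %% 2 < 2)%Z by rewrite modz_ge0 // ltz_mod.
have : (m %% 2)%Z = 0 \/ (m %% 2)%Z = 1 by lia.
case=> r; rewrite r in e.
  have -> : odd `|m|%N = false by rewrite e; lia.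
  by exists (m %/ 2)%Z; rewrite -[RHS]addr0.
have -> : odd `|m|%N = true by rewrite e; lia.
by exists (m %/ 2)%Z.
Qed.

Lemma val2_split (t : int) : t <> 0 ->
  exists k : int, t = 2 ^+ val2 t * (2 * k + 1).
Proof.
move=> t0; have tpos : (0 < `|t|)%N by rewrite absz_gt0; apply/eqP.
have [m /= om mE] := pfactor_coprime (isT : prime 2) tpos.
rewrite coprime2n in om.
have s1 : `|sgz t|%N = 1%N by case: sgzP t0.
have := int_parity (sgz t * m); rewrite abszM s1 mul1n om => -[k kE]; exists k.
rewrite -kE [LHS]intEsg mE PoszM mulrA mulrC; congr (_ * _).
by rewrite /val2; elim: (logn 2 _) => // n IH; rewrite expnS PoszM IH exprS.
Qed.

End Parity.

(** * Equivariance checked on the two generators *)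

Section Generators.
Context (R : realType).
Local Notation R2 := (R * R)%type.
Implicit Types (phi : int * int -> ZsZ) (F : R2 -> R2) (x y : R).

Lemma equivariant_at_generators phi F : equivariant phi F -> forall x y,
  F (x + 1, y) = klein_act (phi (1, 0)) (F (x, y)) /\
  F (x, y + 1) = klein_act (phi (0, 1)) (F (x, y)).
Proof.
by move=> eF x y; rewrite -!eF /torus_shift /= !addr0.
Qed.

Lemma equivariant_from_generators phi F : is_hom phi ->
  (forall x y, F (x + 1, y) = klein_act (phi (1, 0)) (F (x, y))) ->
  (forall x y, F (x, y + 1) = klein_act (phi (0, 1)) (F (x, y))) ->
  equivariant phi F.
Proof.
move=> hom F1 F2.
have phi0 : phi 0 = 1%g.
  by apply: (mulgI (phi 0)); rewrite -hom addr0 mulg1.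
apply: lattice_ind => [[x y]|[x y]|u v Fu Fv p|u Fu p].
- by rewrite -F1 /torus_shift /= addr0.
- by rewrite -F2 /torus_shift /= addr0.
- by rewrite hom torus_shiftD Fu Fv klein_actM.
- have {2}-> : p = torus_shift u (torus_shift (- u) p).
    by rewrite -{1}[u]opprK torus_shiftN.
  by rewrite Fu -klein_actM -hom addNr phi0 klein_act1.
Qed.

End Generators.

(** * The four types of homomorphisms *)

Section Types.
Context (R : realType).
Local Notation R2 := (R * R)%type.
Implicit Types (phi : int * int -> ZsZ) (F : R2 -> R2).

Definition half_shift_recurrent phi : Prop := forall F,
  continuous F -> equivariant phi F ->
  exists p g, F (p.1 + 2^-1, p.2) = klein_act g (F p).

(** This settles Types 1 and 2. The constant first coordinate [i / 2] is fixed by the reflection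
    [x -> i - x], so an affine [F] is equivariant. The half shift raises its second coordinate by
    half an odd integer, while deck transformations raise it by integers. *)
Lemma odd_vertical_not_recurrent phi (i s1 : int) :
  is_hom phi -> phi (1, 0) = (i, 2 * s1 + 1) ->
  (exists s2, phi (0, 1) = (0, 2 * s2) \/ phi (0, 1) = (i, 2 * s2 + 1)) ->
  ~ half_shift_recurrent phi.
Proof.
move=> hom phi1 [s2 phi2] rec.
pose n2 := (phi (0, 1)).2.
pose F (p : R2) : R2 :=
  (i%:~R / 2, (2 * s1 + 1)%:~R * p.1 + n2%:~R * p.2).
have [||[x y] [[a n]]] := rec F.
- by rewrite /F; cts.
- apply: equivariant_from_generators => // x y.
    by rewrite phi1 /klein_act /F /= signz_odd; congr pair; lra.
  rewrite /klein_act /F /= /n2; case: phi2 => ->/=.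
    by rewrite signz_even; congr pair; lra.
  by rewrite signz_odd; congr pair; lra.
rewrite /F /klein_act /= => -[_ e].
have : (2 * s1 + 1)%:~R = (2 * n)%:~R :> R.
  by rewrite [RHS]intrM; lra.
by move/intr_inj; lia.
Qed.

Lemma type4_equivariant phi (r1 r2 s1 s2 : int) F :
  is_hom phi -> type4_with phi r1 r2 s1 s2 ->
  (forall x y, F (x + 1, y) =
    (r1%:~R + (F (x, y)).1, 2 * s1%:~R + (F (x, y)).2)) ->
  (forall x y, F (x, y + 1) =
    (r2%:~R + (F (x, y)).1, 2 * s2%:~R + (F (x, y)).2)) ->
  equivariant phi F.
Proof.
move=> hom [_ phi1 phi2] F1 F2; apply: equivariant_from_generators => // x y.
  by rewrite F1 phi1 /klein_act /= signz_even mul1r intrM.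
by rewrite F2 phi2 /klein_act /= signz_even mul1r intrM.
Qed.

Lemma sn_continuous_comp (f : R2 -> R) :
  continuous f -> continuous (fun p => sn (f p)).
Proof. by move=> cf; apply: continuous_compose cf _; exact: sn_continuous. Qed.

Lemma sn_double (x : R) (k : int) : sn (x + (2 * k)%:~R) = sn x.
Proof. by rewrite snD_int signz_even mul1r. Qed.

Lemma half_sn_lt1 (x : R) : `|2^-1 * sn x| < 1.
Proof. by have := sn_bound x; rewrite ler_norml ltr_norml; lra. Qed.

Lemma int_near (n s : int) (t : R) : `|t| < 1 -> n%:~R = s%:~R + t -> n = s.
Proof.
move=> t1 e; apply/eqP; rewrite -subr_eq0; apply/eqP; apply: (@int_lt1_eq0 R).
by rewrite intrD mulrNz e addrAC subrr add0r.
Qed.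

(* The second coordinates of [p] and of its half shift can only be related by a
   deck transformation at zeros of [sn (2 x)], where the other sine is [1] or
   [-1] and shifts the first coordinate off the deck orbit. *)
Lemma type4_even_not_recurrent phi (r1 r2 s1 s2 : int) :
  is_hom phi -> type4_with phi r1 r2 s1 s2 -> (exists m, s1 = 2 * m) ->
  ~ half_shift_recurrent phi.
Proof.
move=> hom phi4 [m s1E] rec.
pose F (p : R2) : R2 :=
  (r1%:~R * p.1 + r2%:~R * p.2 + 8^-1 * sn (2 * p.1 + 2^-1),
   2 * s1%:~R * p.1 + 2 * s2%:~R * p.2 + 4^-1 * sn (2 * p.1)).
have F1 x y : F (x + 1, y) = (r1%:~R + (F (x, y)).1, 2 * s1%:~R + (F (x, y)).2).
  rewrite /F /=; have -> : 2 * (x + 1) = 2 * x + (2 * 1)%:~R :> R by lra.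
  by rewrite (addrAC (2 * x)) !sn_double; congr pair; lra.
have F2 x y : F (x, y + 1) = (r2%:~R + (F (x, y)).1, 2 * s2%:~R + (F (x, y)).2).
  by rewrite /F /=; congr pair; lra.
have [|[x y] [[a n]]] := rec F _ (type4_equivariant hom phi4 F1 F2).
  have c1 : continuous (fun p : R2 => sn (2 * p.1 + 2^-1)).
    by apply: sn_continuous_comp; cts.
  have c2 : continuous (fun p : R2 => sn (2 * p.1)).
    by apply: sn_continuous_comp; cts.
  by rewrite /F; cts.
rewrite /F /klein_act /=.
have -> : 2 * (x + 2^-1) = 2 * x + 1%:~R :> R by lra.
rewrite (addrAC (2 * x)) !snD_int expr1z => -[e1 e2].
(* The half shift reverses the sign of [sn (2 * x)], so the second coordinates give
   [n = s1 - 2^-1 * sn (2 * x)]; the amplitude [4^-1] keeps the deviation below [1]. *)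
have n_s1 : n = s1.
  apply: (@int_near n s1 (- (2^-1 * sn (2 * x)))); last by lra.
  by rewrite normrN half_sn_lt1.
have [k xk] : exists k : int, 2 * x = k%:~R.
  by apply: sn_eq0; move: e2; rewrite n_s1; lra.
move: e1; rewrite n_s1 s1E signz_even xk addrC snD_int sn_half.
have -> : x = k%:~R / 2 by rewrite -xk; lra.
move=> e1.
(* The amplitude [8^-1] is counted twice, so multiplication by [4] leaves the sign [(-1) ^ k]: an
   even number would equal an odd one. *)
have : (4 * a)%:~R = (2 * r1 - (-1) ^ k)%:~R :> R.
  rewrite intrB !intrM [in RHS]rmorphXz ?unitrN1 // rmorphN1; lra.
move/intr_inj; have : (-1 : int) ^ k = 1 \/ (-1 : int) ^ k = -1.
  by rewrite expN1r -signr_odd; case: odd; [right|left].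
by case=> ->; lia.
Qed.

(* The sine in the second coordinate is constant along the direction [(p', q)],
   along which [r1 x + r2 y] is constant too.  On its zero set
   [2 (r1 x + r2 y) + r1 / 2] is a multiple of [1 / (2 q)], and the constant
   [1 / (8 q)] keeps [2 a + r1 / 2] away from the integers. *)
Lemma type4_odd_not_recurrent phi (r1 r2 s1 s2 p' q : int) :
  is_hom phi -> type4_with phi r1 r2 s1 s2 -> (exists m, s1 = 2 * m + 1) ->
  (exists m, q = 2 * m + 1) -> r1 * p' + r2 * q = 0 ->
  ~ half_shift_recurrent phi.
Proof.
move=> hom phi4 [m s1E] [l qE] rel rec.
have q0 : (q%:~R : R) != 0 by rewrite intr_eq0; apply/eqP; lia.
pose ell (p : R2) : R := q%:~R * p.1 - p'%:~R * p.2.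
pose F (p : R2) : R2 :=
  (r1%:~R * p.1 + r2%:~R * p.2 + (8 * q%:~R)^-1,
   2 * s1%:~R * p.1 + 2 * s2%:~R * p.2 - 4^-1 * sn (2 * ell p)).
have F1 x y : F (x + 1, y) = (r1%:~R + (F (x, y)).1, 2 * s1%:~R + (F (x, y)).2).
  rewrite /F /=.
  have -> : 2 * ell (x + 1, y) = 2 * ell (x, y) + (2 * q)%:~R.
    by rewrite intrM /ell /=; lra.
  by rewrite sn_double; congr pair; lra.
have F2 x y : F (x, y + 1) = (r2%:~R + (F (x, y)).1, 2 * s2%:~R + (F (x, y)).2).
  rewrite /F /=.
  have -> : 2 * ell (x, y + 1) = 2 * ell (x, y) + (2 * - p')%:~R.
    by rewrite intrM mulrNz /ell /=; lra.
  by rewrite sn_double; congr pair; lra.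
have [|[x y] [[a n]]] := rec F _ (type4_equivariant hom phi4 F1 F2).
  have c1 : continuous (fun p : R2 => sn (2 * ell p)).
    by apply: sn_continuous_comp; rewrite /ell; cts.
  by rewrite /F; cts.
rewrite /F /klein_act /=.
have -> : 2 * ell (x + 2^-1, y) = 2 * ell (x, y) + q%:~R.
  by rewrite /ell /=; lra.
rewrite snD_int qE signz_odd -qE => -[e1 e2].
have n_s1 : n = s1.
  apply: (@int_near n s1 (2^-1 * sn (2 * ell (x, y)))); last by lra.
  exact: half_sn_lt1.
have [k xk] : exists k : int, 2 * ell (x, y) = k%:~R.
  by apply: sn_eq0; move: e2; rewrite n_s1; lra.
move: e1; rewrite n_s1 s1E signz_odd => e1.
have relR : r1%:~R * p'%:~R + r2%:~R * q%:~R = 0 :> R.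
  by rewrite -!intrM -intrD rel.
have eq1 : a%:~R =
    2 * (r1%:~R * x + r2%:~R * y) + r1%:~R / 2 + 2 * (8 * q%:~R)^-1.
  by lra.
(* Multiplication by [4 * q] clears the denominators and turns the doubled offset [2 * (8 * q)^-1]
   into [1], so the two sides differ in parity. *)
have : (4 * q * a)%:~R = (4 * r1 * k + 2 * q * r1 + 1)%:~R :> R.
  rewrite !intrD !intrM eq1 -xk /ell /=.
  transitivity (8 * r1%:~R * (q%:~R * x) + 8 * (r2%:~R * q%:~R) * y
    + 2 * q%:~R * r1%:~R + 1 : R); first by field.
  have -> : r2%:~R * q%:~R = - (r1%:~R * p'%:~R) :> R by lra.
  by ring.
by move/intr_inj; lia.
Qed.

(** A zero of [D] calls for a deck transformation with second entry [s1]. If [s1] is odd it reflects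
    the first coordinate, and [E] compares the sum with [i]; if [s1] is even it translates, and [E]
    is the difference. This makes [E] even or odd under the half shift; the reflection in
    [phi (0, 1)] makes it odd under the vertical period. *)
Lemma type3_recurrent phi : type3 phi -> half_shift_recurrent phi.
Proof.
move=> [i [s1 [s2 [_ phi1 phi2]]]] F cF /equivariant_at_generators eF.
pose D (p : R2) : R := (F (p.1 + 2^-1, p.2)).2 - (F p).2 - s1%:~R.
have F1 x y : F (x + 1, y) = ((F (x, y)).1, 2 * s1%:~R + (F (x, y)).2).
  rewrite (eF x y).1 phi1 /klein_act /= signz_even mul1r add0r intrM.
  by [].
have F2 x y : F (x, y + 1) =
    (i%:~R - (F (x, y)).1, (2 * s2 + 1)%:~R + (F (x, y)).2).
  by rewrite (eF x y).2 phi2 /klein_act /= signz_odd mulN1r.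
have half x : x + 2^-1 + 2^-1 = x + 1 :> R by lra.
have cF' : continuous (fun p : R2 => F (p.1 + 2^-1, p.2)).
  by apply: (continuous_compose _ cF); cts.
have cD : continuous D by rewrite /D; cts.
have D1 x y : D (x + 2^-1, y) = - D (x, y) by rewrite /D /= half F1 /=; lra.
have D2 x y : D (x, y + 1) = D (x, y) by rewrite /D /= !F2 /=; lra.
have := int_parity s1; case: ifP => _ [m s1E].
  pose E (p : R2) : R := (F (p.1 + 2^-1, p.2)).1 + (F p).1 - i%:~R.
  have cE : continuous E by rewrite /E; cts.
  have [||p [Dp Ep]] := half_antiperiodic_common_zero cD cE D1 D2.
  - by left=> x y; rewrite /E /= half F1 /=; lra.
  - by move=> x y; rewrite /E /= !F2 /=; lra.
  exists p, (i, s1); rewrite /klein_act /= {1}s1E signz_odd.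
  rewrite [LHS]surjective_pairing; congr pair;
  by move: Dp Ep; rewrite /D /E; lra.
pose E (p : R2) : R := (F (p.1 + 2^-1, p.2)).1 - (F p).1.
have cE : continuous E by rewrite /E; cts.
have [||p [Dp Ep]] := half_antiperiodic_common_zero cD cE D1 D2.
- by right=> x y; rewrite /E /= half F1 /=; lra.
- by move=> x y; rewrite /E /= !F2 /=; lra.
exists p, (0, s1); rewrite /klein_act /= {1}s1E signz_even.
by rewrite [LHS]surjective_pairing; congr pair; move: Dp Ep; rewrite /D /E; lra.
Qed.

(** As [s1] is odd, a deck transformation with second entry [s1] reflects the first coordinate about
    a point of its choice. So at a zero of [D] it suffices that the sum [A] of the two first
    coordinates is an integer. *)
Lemma type4_recurrent phi (r1 r2 s1 s2 u w : int) (e : nat) :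
  type4_with phi r1 r2 s1 s2 -> (exists m, s1 = 2 * m + 1) ->
  r2 = 2 ^+ e * (2 * w + 1) -> r1 = 2 ^+ e.+1 * u -> half_shift_recurrent phi.
Proof.
move=> [_ phi1 phi2] [m s1E] r2E r1E F cF /equivariant_at_generators eF.
have F1 x y : F (x + 1, y) = (r1%:~R + (F (x, y)).1, 2 * s1%:~R + (F (x, y)).2).
  by rewrite (eF x y).1 phi1 /klein_act /= signz_even mul1r intrM.
have F2 x y : F (x, y + 1) = (r2%:~R + (F (x, y)).1, 2 * s2%:~R + (F (x, y)).2).
  by rewrite (eF x y).2 phi2 /klein_act /= signz_even mul1r intrM.
have half x : x + 2^-1 + 2^-1 = x + 1 :> R by lra.
have cF' : continuous (fun p : R2 => F (p.1 + 2^-1, p.2)).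
  by apply: (continuous_compose _ cF); cts.
pose D (p : R2) : R := (F (p.1 + 2^-1, p.2)).2 - (F p).2 - s1%:~R.
have cD : continuous D by rewrite /D; cts.
have D1 x y : D (x + 2^-1, y) = - D (x, y) by rewrite /D /= half F1 /=; lra.
have D2 x y : D (x, y + 1) = D (x, y) by rewrite /D /= !F2 /=; lra.
(* This scaling makes [c * A] change by the integers [u] and [2 w + 1] along
   the half period and the period, whereas [A] is an integer where
   [sn (c * A)] vanishes. *)
pose c : R := (2 ^+ e.+1)^-1.
have c0 : 2 ^+ e.+1 != 0 :> R by rewrite expf_neq0 // pnatr_eq0.
pose A (p : R2) : R := (F (p.1 + 2^-1, p.2)).1 + (F p).1.
have cA : continuous (fun p : R2 => sn (c * A p)).
  by apply: sn_continuous_comp; rewrite /A; cts.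
have A1 x y : c * A (x + 2^-1, y) = c * A (x, y) + u%:~R.
  have -> : u%:~R = c * r1%:~R :> R.
    by rewrite r1E intrM rmorphXn /= mulKf.
  by rewrite /A /= half F1 /=; ring.
have A2 x y : c * A (x, y + 1) = c * A (x, y) + (2 * w + 1)%:~R.
  have -> : (2 * w + 1)%:~R = c * (2 * r2%:~R) :> R.
    by rewrite r2E intrM rmorphXn /= mulrA -exprS mulKf.
  by rewrite /A /= !F2 /=; ring.
have [||p [Dp snA]] := half_antiperiodic_common_zero cD cA D1 D2.
- have := int_parity u; case: ifP => _ [v uE]; rewrite uE in A1.
    by right=> x y; rewrite A1 snD_int signz_odd mulN1r.
  by left=> x y; rewrite A1 snD_int signz_even mul1r.
- by move=> x y; rewrite A2 snD_int signz_odd mulN1r.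
have [k Ak] := sn_eq0 snA.
have Ap : A p = (2 ^+ e.+1 * k)%:~R.
  by rewrite intrM rmorphXn /= -Ak mulVKf.
exists p, (2 ^+ e.+1 * k, s1); rewrite /klein_act /= {1}s1E signz_odd -Ap.
by rewrite [LHS]surjective_pairing; congr pair; move: Dp; rewrite /D /A; lra.
Qed.

End Types.

(** * The criterion in terms of types and valuations *)

Theorem theorem1p3 (R : realType) (beta : homotopy_class R (torus R) (klein R))
    (phi : int * int -> ZsZ) (phi_beta : beta_sharp beta phi) :
  borsuk_ulam (tau1 R) beta <->
  (type3 phi \/
   exists r1 r2 s1 s2 : int,
     [/\ type4_with phi r1 r2 s1 s2, odd `|s1|%N, r2 <> 0 &
         r1 <> 0 -> (val2 r2 < val2 r1)%N]).
Proof.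
have [hom types _] := phi_beta.
split=> [/(borsuk_ulam_equivariant phi_beta) rec|cond].
  case: types => [type1|[type2|[|]]].
  - move: type1 => [i [s1 [s2 [_ phi1 phi2]]]]; exfalso.
    by apply: (odd_vertical_not_recurrent hom phi1 _ rec); exists s2; left.
  - move: type2 => [i [s1 [s2 [_ phi1 phi2]]]]; exfalso.
    by apply: (odd_vertical_not_recurrent hom phi1 _ rec); exists s2; right.
  - by left.
  move=> [r1 [r2 [s1 [s2 phi4]]]]; right; exists r1, r2, s1, s2.
  have := int_parity s1; case: ifP => [s1odd s1E|_ s1E]; last first.
    by have := type4_even_not_recurrent hom phi4 s1E rec.
  have norel p' q :=
    @type4_odd_not_recurrent R phi r1 r2 s1 s2 p' q hom phi4 s1E.
  have r20 : r2 <> 0.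
    by move=> r20; apply: (norel 0 1 _ _ rec); [exists 0 | rewrite r20; lia].
  split => // r10; rewrite ltnNge; apply/negP => le12.
  have [k r1E] := val2_split r10; have [l r2E] := val2_split r20.
  (* With [q] the odd part of [r1], solving [r1 * p' + r2 * q = 0] gives [p'] as [- r2] divided by
     the power of [2] in [r1], an integer by [le12]. *)
  pose p' := - (2 ^+ (val2 r2 - val2 r1) * (2 * l + 1)) : int.
  apply: (norel p' (2 * k + 1) _ _ rec); rewrite ?/p'.
    by exists k.
  move: r1E r2E le12; set v1 := val2 r1; set v2 := val2 r2 => r1E r2E le12.
  rewrite r1E r2E -{2}(subnK le12) exprD; ring.
apply/(borsuk_ulam_equivariant phi_beta); case: cond => [|].
  exact: type3_recurrent.
move=> [r1 [r2 [s1 [s2 [phi4 s1odd r20 r12]]]]].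
have := int_parity s1; rewrite s1odd => s1E.
have [w r2E] := val2_split r20.
have [u r1E] : exists u, r1 = 2 ^+ (val2 r2).+1 * u.
  (* Zero is divisible by every power of [2], whereas [val2 0] is [0]; hence the separate case. *)
  have [->|/eqP r10] := eqVneq r1 0; first by exists 0; rewrite mulr0.
  have [k r1E] := val2_split r10.
  exists (2 ^+ (val2 r1 - (val2 r2).+1) * (2 * k + 1)).
  by rewrite mulrA -exprD subnKC //; exact: r12.
exact: type4_recurrent phi4 s1E r2E r1E.
Qed.
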